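(* Let $\mathcal{X}$ be a finite alphabet and let $\mathcal{N}: x\mapsto \rho^{BC}_x$ be a classical-quantum broadcast channel, where each $\rho^{BC}_x$ is a density operator on $\mathcal{H}_B\otimes\mathcal{H}_C$. Let $(U,V)$ be a pair of random variables with joint distribution $p_{UV}$ on finite sets $\mathcal{U}\times\mathcal{V}$, and let $f:\mathcal{U}\times\mathcal{V}\to\mathcal{X}$. Consider the state $$\rho^{UVBC}=\sum_{(u,v)\in\mathcal{U}\times\mathcal{V}} p_{UV}(u,v)\,|u\rangle\langle u|^U\otimes |v\rangle\langle v|^V\otimes \rho^{BC}_{f(u,v)},$$ and let $\rho^{UB},\rho^{VC}$ be its reduced states. Let $\varepsilon_0\in[0,1)$, $\varepsilon_\infty\in[0,\tfrac14]$, $\tilde\varepsilon\in(0,1)$ and $\varepsilon>0$ satisfy $40\tilde\varepsilon+16\varepsilon_0\le\varepsilon$, and let $R_1,R_2\ge 0$ (with $2^{R_1},2^{R_2}$ integers) satisfy $$R_1\le I_0^{\varepsilon_0}[U;B]-5\log\tfrac{1}{\tilde\varepsilon}-2,\qquad R_2\le I_0^{\varepsilon_0}[V;C]-5\log\tfrac{1}{\tilde\varepsilon}-2,$$ $$R_1+R_2\le I_0^{\varepsilon_0}[U;B]+I_0^{\varepsilon_0}[V;C]-I_\infty^{\varepsilon_\infty}[U;V]-11\log\tfrac{1}{\tilde\varepsilon}-5,$$ where all quantities are computed with respect to $\rho^{UVBC}$. Then there exists an $(R_1,R_2,\varepsilon)$-classical-quantum broadcast channel code for $\mathcal{N}$.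
   Context: All logarithms are base 2; $[N]=\{1,\dots,N\}$. For a classical-quantum state $\rho^{UB}=\sum_u p_U(u)|u\rangle\langle u|^U\otimes\rho^B_u$ with marginals $\rho^U,\rho^B$ and $\varepsilon\in[0,1)$, the smooth min Rényi divergence is $I_0^{\varepsilon}[U;B]=\sup\{-\log\mathrm{Tr}[\Gamma^{UB}(\rho^U\otimes\rho^B)] : 0\preceq\Gamma^{UB}\preceq\mathbb{I},\ \mathrm{Tr}[\Gamma^{UB}\rho^{UB}]>1-\varepsilon\}$. For random variables $(U,V)\sim p_{UV}$ on $\mathcal{U}\times\mathcal{V}$ with marginals $p_U,p_V$ and $\varepsilon\in[0,1)$, the smooth max Rényi divergence is $I_\infty^{\varepsilon}[U;V]=\inf_{\mathcal{G}\subseteq\mathcal{U}\times\mathcal{V},\ p_{UV}(\mathcal{G})>1-\varepsilon}\ \sup_{(u,v)\in\mathcal{G}}\log\frac{p_{UV}(u,v)}{p_U(u)p_V(v)}$. For a channel $\mathcal{N}:x\mapsto\rho^{BC}_x$, write $\rho^B_x=\mathrm{Tr}_C\rho^{BC}_x$, $\rho^C_x=\mathrm{Tr}_B\rho^{BC}_x$. An $(R_1,R_2,\varepsilon)$-classical-quantum broadcast channel code consists of an encoding function $F:[2^{R_1}]\times[2^{R_2}]\to\mathcal{X}$ and two POVMs $\{\mathcal{T}^B_{m_1}:m_1\in[2^{R_1}]\}$ on $\mathcal{H}_B$ and $\{\mathcal{T}^C_{m_2}:m_2\in[2^{R_2}]\}$ on $\mathcal{H}_C$ such that $\frac{1}{2^{R_1+R_2}}\sum_{(m_1,m_2)}\mathrm{Tr}[(\mathbb{I}-\mathcal{T}^B_{m_1}\otimes\mathcal{T}^C_{m_2})\rho^{BC}_{F(m_1,m_2)}]\le\varepsilon$.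 *)

(* Defs.v *)
(* classical reals.  Finite-dimensional complex matrices are
   encoded by hand (complex numbers as pairs of reals; an n x n matrix is a
   function nat -> nat -> C of which only indices < n are used). *)
From Stdlib Require Import Reals Lra Lia Arith.
Open Scope R_scope.

Record C := mkC { re : R; im : R }.
Definition C0 : C := mkC 0 0.
Definition C1 : C := mkC 1 0.
Definition Cadd (a b : C) : C := mkC (re a + re b) (im a + im b).
Definition Copp (a : C) : C := mkC (- re a) (- im a).
Definition Cmul (a b : C) : C :=
  mkC (re a * re b - im a * im b) (re a * im b + im a * re b).
Definition Cconj (a : C) : C := mkC (re a) (- im a).
Definition Cscale (r : R) (a : C) : C := mkC (r * re a) (r * im a).

Fixpoint csum (n : nat) (f : nat -> C) : C :=
  match n with O => C0 | S k => Cadd (csum k f) (f k) end.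
Fixpoint rsum (n : nat) (f : nat -> R) : R :=
  match n with O => 0 | S k => rsum k f + f k end.

Definition Mat := nat -> nat -> C.
Definition idm : Mat := fun i j => if Nat.eqb i j then C1 else C0.
Definition msub (A B : Mat) : Mat := fun i j => Cadd (A i j) (Copp (B i j)).
Definition mscale (r : R) (A : Mat) : Mat := fun i j => Cscale r (A i j).
Definition msum (n : nat) (F : nat -> Mat) : Mat :=
  fun i j => csum n (fun k => F k i j).
Definition mmul (d : nat) (A B : Mat) : Mat :=
  fun i j => csum d (fun k => Cmul (A i k) (B k j)).
Definition mtrace (d : nat) (A : Mat) : C := csum d (fun i => A i i).
Definition proj (u : nat) : Mat :=
  fun i j => if andb (Nat.eqb i u) (Nat.eqb j u) then C1 else C0.
(* Kronecker product A (x) B, B acting on a space of dimension d2;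
   basis index of |a>|b> is a*d2+b *)
Definition kron (d2 : nat) (A B : Mat) : Mat :=
  fun i j => Cmul (A (i / d2)%nat (j / d2)%nat) (B (i mod d2)%nat (j mod d2)%nat).
Definition ptrC (dC : nat) (M : Mat) : Mat :=
  fun i j => csum dC (fun k => M (i * dC + k)%nat (j * dC + k)%nat).
Definition ptrB (dB dC : nat) (M : Mat) : Mat :=
  fun i j => csum dB (fun k => M (k * dC + i)%nat (k * dC + j)%nat).

Definition hermitian (d : nat) (A : Mat) : Prop :=
  forall i j, (i < d)%nat -> (j < d)%nat -> A i j = Cconj (A j i).
Definition psd (d : nat) (A : Mat) : Prop :=
  hermitian d A /\
  forall v : nat -> C,
    0 <= re (csum d (fun i => Cmul (Cconj (v i)) (csum d (fun j => Cmul (A i j) (v j))))).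
Definition density (d : nat) (rho : Mat) : Prop :=
  psd d rho /\ mtrace d rho = C1.
Definition povm (d n : nat) (T : nat -> Mat) : Prop :=
  (forall m, (m < n)%nat -> psd d (T m)) /\
  (forall i j, (i < d)%nat -> (j < d)%nat -> msum n T i j = idm i j).

Inductive Rbar := Fin (r : R) | PInf | MInf.
Definition Rbar_le (x y : Rbar) : Prop :=
  match x, y with
  | MInf, _ => True
  | _, PInf => True
  | Fin a, Fin b => a <= b
  | _, _ => False
  end.
(* the case PInf + MInf never arises in the theorem *)
Definition Rbar_plus (x y : Rbar) : Rbar :=
  match x, y with
  | Fin a, Fin b => Fin (a + b)
  | MInf, _ | _, MInf => MInf
  | _, _ => PInf
  end.
Definition is_Rbar_sup (S : Rbar -> Prop) (x : Rbar) : Prop :=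
  (forall s, S s -> Rbar_le s x) /\
  (forall y, (forall s, S s -> Rbar_le s y) -> Rbar_le x y).
Definition is_Rbar_inf (S : Rbar -> Prop) (x : Rbar) : Prop :=
  (forall s, S s -> Rbar_le x s) /\
  (forall y, (forall s, S s -> Rbar_le y s) -> Rbar_le y x).

Definition log2 (x : R) : R := ln x / ln 2.
Definition neglog2 (t : R) : Rbar :=
  if Req_EM_T t 0 then PInf else Fin (- log2 t).

Section States.
Variables (dB dC nu nv : nat) (rho : nat -> Mat) (p : nat -> nat -> R)
          (f : nat -> nat -> nat).

Definition pU (u : nat) : R := rsum nv (fun v => p u v).
Definition pV (v : nat) : R := rsum nu (fun u => p u v).
Definition rhoB_x (x : nat) : Mat := ptrC dC (rho x).
Definition rhoC_x (x : nat) : Mat := ptrB dB dC (rho x).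

Definition rhoUB : Mat := msum nu (fun u => msum nv (fun v =>
  mscale (p u v) (kron dB (proj u) (rhoB_x (f u v))))).
Definition rhoVC : Mat := msum nu (fun u => msum nv (fun v =>
  mscale (p u v) (kron dC (proj v) (rhoC_x (f u v))))).
Definition rhoU : Mat := msum nu (fun u => mscale (pU u) (proj u)).
Definition rhoV : Mat := msum nv (fun v => mscale (pV v) (proj v)).
Definition rhoB : Mat := msum nu (fun u => msum nv (fun v =>
  mscale (p u v) (rhoB_x (f u v)))).
Definition rhoC : Mat := msum nu (fun u => msum nv (fun v =>
  mscale (p u v) (rhoC_x (f u v)))).
End States.

Definition I0_values (D : nat) (rhoJ sigma : Mat) (eps : R) : Rbar -> Prop :=
  fun s => exists Gam : Mat,
    psd D Gam /\ psd D (msub idm Gam) /\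
    re (mtrace D (mmul D Gam rhoJ)) > 1 - eps /\
    s = neglog2 (re (mtrace D (mmul D Gam sigma))).
Definition is_I0 (D : nat) (rhoJ sigma : Mat) (eps : R) (x : Rbar) : Prop :=
  is_Rbar_sup (I0_values D rhoJ sigma eps) x.

Definition logratio (nu nv : nat) (p : nat -> nat -> R) (u v : nat) : Rbar :=
  if Req_EM_T (p u v) 0 then MInf
  else Fin (log2 (p u v / (pU nv p u * pV nu p v))).
Definition G_values (nu nv : nat) (p : nat -> nat -> R) (G : nat -> nat -> bool)
  : Rbar -> Prop :=
  fun s => exists u v, (u < nu)%nat /\ (v < nv)%nat /\ G u v = true /\
                       s = logratio nu nv p u v.
Definition probG (nu nv : nat) (p : nat -> nat -> R) (G : nat -> nat -> bool) : R :=
  rsum nu (fun u => rsum nv (fun v => if G u v then p u v else 0)).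
Definition Iinf_values (nu nv : nat) (p : nat -> nat -> R) (eps : R) : Rbar -> Prop :=
  fun s => exists G, probG nu nv p G > 1 - eps /\ is_Rbar_sup (G_values nu nv p G) s.
Definition is_Iinf (nu nv : nat) (p : nat -> nat -> R) (eps : R) (x : Rbar) : Prop :=
  is_Rbar_inf (Iinf_values nu nv p eps) x.

(* Main.v *)
(** Random coding with bins, as in Marton's argument.  Every message [m1] owns [K]
    codewords drawn from [p_U], every [m2] owns [L] codewords drawn from [p_V], and the
    encoder picks the cheapest pair of a bin.  With the weights
    [w = p_UV 1_G / (p_U p_V)], this pair costs no more than the average over the bin for
    the distribution proportional to [w]; by Chebyshev the total weight of a bin is at
    least two thirds of its mean with high probability, and reweighting by [w] turns a pair
    of independent codewords into a pair with law [p_UV] restricted to [G].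

    The decoders test the codewords one after the other.  The test of an effect [Gam]
    continues with the vector [x - Gam x] when it fails, so that no operator square roots
    are needed, and Gao's union bound controls the error by four times the sum of the
    individual errors.  Hence the total error is at most
    [16 (eps0 + epst) + 24 epst]. *)

From Stdlib Require Import Reals Lra Lia Arith ZArith Classical ClassicalEpsilon.
Require Import Defs.
Open Scope R_scope.

(** The encoder's choice depends on all codewords of a bin, so the competing codewords are not
    independent of the transmitted pair. The weighted average removes this obstacle: each of its
    terms is the cost of one fixed pair times [w], and [w] looks at that pair only, so a competitor,
    even one from the same bin, remains an independent letter of law [p_U] or [p_V]. What results is
    the pairing with a product state that defines [I_0]. The random denominator of the average is
    replaced by a constant off the Chebyshev event, which leaves an expression whose expectation is
    computed term by term.

    The bin sizes are pulled in two directions. False alarms require [M1 K tB] and [M2 L tC] to be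
    at most [epst], while concentration of the bin weight requires [Lam + K + L] to be small against
    [epst K L], where [Lam] bounds [w]. The sum-rate condition takes care of [Lam]; the individual
    rate conditions make [K] and [L] at least of order [1 / epst], which takes care of [K + L]. *)

(** * Finite real sums and minimisers *)

Lemma rsum_ext n f g : (forall k, (k < n)%nat -> f k = g k) -> rsum n f = rsum n g.
Proof.
  induction n as [|n IH]; intros H; simpl; [reflexivity|].
  rewrite IH, H by auto; reflexivity.
Qed.

Lemma rsum_le n f g : (forall k, (k < n)%nat -> f k <= g k) -> rsum n f <= rsum n g.
Proof.
  induction n as [|n IH]; intros H; simpl; [lra|].
  apply Rplus_le_compat; auto.
Qed.

Lemma rsum_plus n f g : rsum n (fun k => f k + g k) = rsum n f + rsum n g.
Proof. induction n as [|n IH]; simpl; [|rewrite IH]; ring. Qed.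

Lemma rsum_scal n r f : rsum n (fun k => r * f k) = r * rsum n f.
Proof. induction n as [|n IH]; simpl; [|rewrite IH]; ring. Qed.

Lemma rsum_scalr n r f : rsum n (fun k => f k * r) = rsum n f * r.
Proof. induction n as [|n IH]; simpl; [|rewrite IH]; ring. Qed.

Lemma rsum_const n r : rsum n (fun _ => r) = INR n * r.
Proof.
  induction n as [|n IH]; [simpl; ring|].
  rewrite S_INR; simpl rsum; rewrite IH; ring.
Qed.

Lemma rsum_nonneg n f : (forall k, (k < n)%nat -> 0 <= f k) -> 0 <= rsum n f.
Proof.
  intros H; replace 0 with (rsum n (fun _ => 0)) by (rewrite rsum_const; ring).
  now apply rsum_le.
Qed.

Lemma rsum_ge_term n f k :
  (forall i, (i < n)%nat -> 0 <= f i) -> (k < n)%nat -> f k <= rsum n f.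
Proof.
  induction n as [|n IH]; intros H Hk; [lia|]; simpl.
  destruct (Nat.eq_dec k n) as [->|Hne].
  - assert (0 <= rsum n f) by (apply rsum_nonneg; auto). lra.
  - assert (f k <= rsum n f) by (apply IH; [auto|lia]).
    assert (0 <= f n) by auto. lra.
Qed.

Lemma rsum_swap n m f :
  rsum n (fun i => rsum m (fun j => f i j)) = rsum m (fun j => rsum n (fun i => f i j)).
Proof.
  induction n as [|n IH]; simpl.
  - rewrite rsum_const; ring.
  - now rewrite IH, <- rsum_plus.
Qed.

Lemma rsum_eqb n k f :
  (k < n)%nat -> rsum n (fun i => if Nat.eqb k i then f i else 0) = f k.
Proof.
  induction n as [|n IH]; intros Hk; [lia|]; simpl.
  destruct (Nat.eqb_spec k n) as [->|Hne].
  - rewrite (rsum_ext n _ (fun _ => 0)), rsum_const; [ring|].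
    intros i Hi; destruct (Nat.eqb_spec n i); [lia|reflexivity].
  - rewrite IH by lia; ring.
Qed.

Lemma rsum_mul_index n d f :
  rsum (n * d) f = rsum n (fun a => rsum d (fun b => f (a * d + b)%nat)).
Proof.
  assert (Hadd : forall m k, rsum (m + k) f = rsum m f + rsum k (fun b => f (m + b)%nat)).
  { intros m k; induction k as [|k IH]; simpl.
    - rewrite Nat.add_0_r; ring.
    - rewrite Nat.add_succ_r; simpl; rewrite IH; ring. }
  induction n as [|n IH]; [reflexivity|].
  simpl rsum; rewrite Nat.add_comm, Hadd, IH; reflexivity.
Qed.

Fixpoint argmin (n : nat) (f : nat -> R) : nat :=
  match n with
  | O => O
  | S k => if Rlt_dec (f k) (f (argmin k f)) then k else argmin k f
  end.

Lemma argmin_lt n f : (0 < n)%nat -> (argmin n f < n)%nat.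
Proof.
  induction n as [|n IH]; intros Hn; [lia|]; simpl.
  destruct (Rlt_dec _ _); [lia|].
  destruct n as [|n]; [simpl; lia|]. assert (argmin (S n) f < S n)%nat by (apply IH; lia). lia.
Qed.

Lemma argmin_le n f k : (k < n)%nat -> f (argmin n f) <= f k.
Proof.
  induction n as [|n IH]; intros Hk; [lia|]; simpl.
  destruct (Nat.eq_dec k n) as [->|Hne].
  - destruct (Rlt_dec _ _); lra.
  - assert (f (argmin n f) <= f k) by (apply IH; lia). destruct (Rlt_dec _ _); lra.
Qed.

(** The average is left unnormalised, so weights of total 0 need no separate case. *)
Lemma argmin_le_average n q a :
  (forall k, (k < n)%nat -> 0 <= q k) ->
  a (argmin n a) * rsum n q <= rsum n (fun k => q k * a k).
Proof.
  intros Hq; rewrite <- rsum_scal; apply rsum_le; intros k Hk.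
  rewrite Rmult_comm; apply Rmult_le_compat_l; [auto|now apply argmin_le].
Qed.

(** * Independent codewords *)

Definition upd (c : nat -> nat) (k u : nat) : nat -> nat :=
  fun i => if Nat.eqb i k then u else c i.

(* Expectation of [F c] when [c 0, ..., c (n-1)] are independent with law [q] on
   [{0, ..., s-1}] and all later entries of [c] are [0]. *)
Fixpoint iidE (q : nat -> R) (s n : nat) (F : (nat -> nat) -> R) : R :=
  match n with
  | O => F (fun _ => O)
  | S k => rsum s (fun u => q u * iidE q s k (fun c => F (upd c k u)))
  end.

Section Expectation.
Context (q : nat -> R) (s : nat).
Context (q_nonneg : forall u, (u < s)%nat -> 0 <= q u) (q_sum : rsum s q = 1).

Lemma iidE_ext n F G : (forall c, F c = G c) -> iidE q s n F = iidE q s n G.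
Proof.
  revert F G; induction n as [|n IH]; intros F G H; simpl; [auto|].
  apply rsum_ext; intros u _; f_equal; auto.
Qed.

Lemma iidE_plus n F G : iidE q s n (fun c => F c + G c) = iidE q s n F + iidE q s n G.
Proof.
  revert F G; induction n as [|n IH]; intros F G; simpl; [auto|].
  rewrite <- rsum_plus; apply rsum_ext; intros u _; rewrite IH; ring.
Qed.

Lemma iidE_scal n r F : iidE q s n (fun c => r * F c) = r * iidE q s n F.
Proof.
  revert F; induction n as [|n IH]; intros F; simpl; [auto|].
  rewrite <- rsum_scal; apply rsum_ext; intros u _; rewrite IH; ring.
Qed.

Lemma iidE_const n r : iidE q s n (fun _ => r) = r.
Proof.
  induction n as [|n IH]; simpl; [auto|].
  rewrite IH, rsum_scalr, q_sum; ring.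
Qed.

Lemma iidE_rsum n m F :
  iidE q s n (fun c => rsum m (fun k => F k c)) = rsum m (fun k => iidE q s n (F k)).
Proof.
  induction m as [|m IH]; simpl; [apply iidE_const|].
  now rewrite iidE_plus, IH.
Qed.

Lemma iidE_one n i h :
  (i < n)%nat -> iidE q s n (fun c => h (c i)) = rsum s (fun u => q u * h u).
Proof.
  induction n as [|n IH]; intros Hi; [lia|]; simpl; unfold upd.
  destruct (Nat.eqb_spec i n) as [->|Hne].
  - apply rsum_ext; intros u _; now rewrite iidE_const.
  - rewrite rsum_scalr, IH by lia; rewrite q_sum; ring.
Qed.

Lemma iidE_two n i j h :
  (i < n)%nat -> (j < n)%nat -> i <> j ->
  iidE q s n (fun c => h (c i) (c j))
  = rsum s (fun u => q u * rsum s (fun u' => q u' * h u u')).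
Proof.
  induction n as [|n IH]; intros Hi Hj Hij; [lia|]; simpl; unfold upd.
  destruct (Nat.eqb_spec i n) as [->|Hin]; destruct (Nat.eqb_spec j n) as [->|Hjn].
  - lia.
  - apply rsum_ext; intros u _; now rewrite iidE_one by lia.
  - transitivity (rsum s (fun u => q u * rsum s (fun u' => q u' * h u' u))).
    + apply rsum_ext; intros u _; now rewrite (iidE_one n i (fun x => h x u)) by lia.
    + transitivity (rsum s (fun u => rsum s (fun u' => q u * (q u' * h u' u)))).
      { apply rsum_ext; intros u _; now rewrite rsum_scal. }
      rewrite rsum_swap; apply rsum_ext; intros u _.
      rewrite <- rsum_scal; apply rsum_ext; intros u' _; ring.
  - rewrite rsum_scalr, IH by lia; rewrite q_sum; ring.
Qed.

(** Method of conditional expectations: the letters are fixed one at a time, each at a minimiser of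
    the remaining expectation. *)
Lemma iidE_attained n F :
  exists c, (forall i, (c i < s)%nat) /\ F c <= iidE q s n F.
Proof.
  (* Total mass 1 forces a nonempty alphabet; this also makes the default entry [0] beyond position
     [n] a legal letter. *)
  assert (Hs : (0 < s)%nat).
  { destruct s; [simpl in q_sum; lra|lia]. }
  revert F; induction n as [|n IH]; intros F; simpl.
  - exists (fun _ => O); split; [auto|apply Rle_refl].
  - set (a := fun u => iidE q s n (fun c => F (upd c n u))).
    set (u0 := argmin s a).
    destruct (IH (fun c => F (upd c n u0))) as [c [Hc Hle]].
    exists (upd c n u0); split.
    + intros i; unfold upd; destruct (Nat.eqb i n); [now apply argmin_lt|auto].
    + apply Rle_trans with (1 := Hle).
      assert (H := argmin_le_average s q a q_nonneg).
      rewrite q_sum, Rmult_1_r in H; exact H.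
Qed.

End Expectation.

(** * Two independent codebooks *)

Section TwoCodebooks.
Context (qU qV : nat -> R) (nu nv n1 n2 : nat).
Context (qU_nonneg : forall u, (u < nu)%nat -> 0 <= qU u) (qU_sum : rsum nu qU = 1).
Context (qV_nonneg : forall v, (v < nv)%nat -> 0 <= qV v) (qV_sum : rsum nv qV = 1).

Definition iidE2 (F : (nat -> nat) -> (nat -> nat) -> R) : R :=
  iidE qU nu n1 (fun c => iidE qV nv n2 (fun c' => F c c')).

Lemma iidE2_ext F H : (forall c c', F c c' = H c c') -> iidE2 F = iidE2 H.
Proof. intros E; apply iidE_ext; intros c; apply iidE_ext; auto. Qed.

Lemma iidE2_plus F H : iidE2 (fun c c' => F c c' + H c c') = iidE2 F + iidE2 H.
Proof.
  unfold iidE2; rewrite <- iidE_plus; apply iidE_ext; intros c; apply iidE_plus.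
Qed.

Lemma iidE2_scal r F : iidE2 (fun c c' => r * F c c') = r * iidE2 F.
Proof.
  unfold iidE2; rewrite <- iidE_scal; apply iidE_ext; intros c; apply iidE_scal.
Qed.

Lemma iidE2_const r : iidE2 (fun _ _ => r) = r.
Proof.
  transitivity (iidE qU nu n1 (fun _ => r)); [|now apply iidE_const].
  apply iidE_ext; intros c; now apply iidE_const.
Qed.

Lemma iidE2_rsum m F :
  iidE2 (fun c c' => rsum m (fun k => F k c c')) = rsum m (fun k => iidE2 (F k)).
Proof.
  unfold iidE2; rewrite <- iidE_rsum by auto; apply iidE_ext; intros c; now rewrite <- iidE_rsum.
Qed.

Lemma iidE2_one i j h :
  (i < n1)%nat -> (j < n2)%nat ->
  iidE2 (fun c c' => h (c i) (c' j))
  = rsum nu (fun u => rsum nv (fun v => qU u * qV v * h u v)).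
Proof.
  intros Hi Hj; unfold iidE2.
  rewrite (iidE_ext _ _ _ _ (fun c => rsum nv (fun v => qV v * h (c i) v)))
    by (intros c; now rewrite (iidE_one qV nv qV_sum n2 j (h (c i)))).
  rewrite (iidE_one qU nu qU_sum n1 i (fun u => rsum nv (fun v => qV v * h u v))) by auto.
  apply rsum_ext; intros u _; rewrite <- rsum_scal; apply rsum_ext; intros v _; ring.
Qed.

(** The competing letter [u'] is summed outermost, so that after the change of measure the right
    side has the shape of a trace against a product state. *)
Lemma iidE2_left i i' j h :
  (i < n1)%nat -> (i' < n1)%nat -> (j < n2)%nat -> i <> i' ->
  iidE2 (fun c c' => h (c i) (c i') (c' j))
  = rsum nu (fun u' => qU u' * rsum nu (fun u => rsum nv (fun v => qU u * qV v * h u u' v))).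
Proof.
  intros Hi Hi' Hj Hne; unfold iidE2.
  rewrite (iidE_ext _ _ _ _ (fun c => rsum nv (fun v => qV v * h (c i) (c i') v)))
    by (intros c; now rewrite (iidE_one qV nv qV_sum n2 j (h (c i) (c i')))).
  rewrite (iidE_two qU nu qU_sum n1 i' i (fun u' u => rsum nv (fun v => qV v * h u u' v)))
    by auto.
  apply rsum_ext; intros u' _; f_equal; apply rsum_ext; intros u _.
  rewrite <- rsum_scal; apply rsum_ext; intros v _; ring.
Qed.

Lemma iidE2_right i j j' h :
  (i < n1)%nat -> (j < n2)%nat -> (j' < n2)%nat -> j <> j' ->
  iidE2 (fun c c' => h (c i) (c' j) (c' j'))
  = rsum nv (fun v' => qV v' * rsum nu (fun u => rsum nv (fun v => qU u * qV v * h u v v'))).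
Proof.
  intros Hi Hj Hj' Hne; unfold iidE2.
  rewrite (iidE_ext _ _ _ _
    (fun c => rsum nv (fun v' => qV v' * rsum nv (fun v => qV v * h (c i) v v'))))
    by (intros c; now rewrite (iidE_two qV nv qV_sum n2 j' j (fun v' v => h (c i) v v')) by auto).
  rewrite iidE_rsum by auto; apply rsum_ext; intros v' _.
  rewrite iidE_scal; f_equal.
  rewrite (iidE_one qU nu qU_sum n1 i (fun u => rsum nv (fun v => qV v * h u v v'))) by auto.
  apply rsum_ext; intros u _; rewrite <- rsum_scal; apply rsum_ext; intros v _; ring.
Qed.

Lemma iidE2_attained F :
  exists c c', (forall i, (c i < nu)%nat) /\ (forall j, (c' j < nv)%nat) /\
               F c c' <= iidE2 F.
Proof.
  destruct (iidE_attained qU nu qU_nonneg qU_sum n1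
              (fun c => iidE qV nv n2 (fun c' => F c c'))) as [c [Hc Hle]].
  destruct (iidE_attained qV nv qV_nonneg qV_sum n2 (F c)) as [c' [Hc' Hle']].
  exists c, c'; repeat split; auto; exact (Rle_trans _ _ _ Hle' Hle).
Qed.

(** * Second moment of the weight of a bin *)

Context (w : nat -> nat -> R) (Lam g : R).
Context (w_nonneg : forall u v, (u < nu)%nat -> (v < nv)%nat -> 0 <= w u v).
Context (w_le : forall u v, (u < nu)%nat -> (v < nv)%nat -> w u v <= Lam).
Context (w_row : forall u, (u < nu)%nat -> rsum nv (fun v => qV v * w u v) <= 1).
Context (w_col : forall v, (v < nv)%nat -> rsum nu (fun u => qU u * w u v) <= 1).
Context (w_mean : rsum nu (fun u => rsum nv (fun v => qU u * qV v * w u v)) = g).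

Lemma w_mean_row : rsum nu (fun u => qU u * rsum nv (fun v => qV v * w u v)) = g.
Proof.
  rewrite <- w_mean; apply rsum_ext; intros u _; rewrite <- rsum_scal.
  apply rsum_ext; intros v _; ring.
Qed.

Lemma w_mean_col : rsum nv (fun v => qV v * rsum nu (fun u => qU u * w u v)) = g.
Proof.
  rewrite <- w_mean, rsum_swap; apply rsum_ext; intros v _; rewrite <- rsum_scal.
  apply rsum_ext; intros u _; ring.
Qed.

Lemma rsum_square_le n q h :
  (forall k, (k < n)%nat -> 0 <= q k) -> (forall k, (k < n)%nat -> 0 <= h k <= 1) ->
  rsum n (fun k => q k * (h k * h k)) <= rsum n (fun k => q k * h k).
Proof.
  intros Hq Hh; apply rsum_le; intros k Hk; apply Rmult_le_compat_l; auto.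
  destruct (Hh k Hk); nra.
Qed.

Lemma w_pair_distinct i i' j j' :
  (i < n1)%nat -> (i' < n1)%nat -> (j < n2)%nat -> (j' < n2)%nat -> i <> i' -> j <> j' ->
  iidE2 (fun c c' => w (c i) (c' j) * w (c i') (c' j')) = g * g.
Proof.
  intros Hi Hi' Hj Hj' Hii Hjj; unfold iidE2.
  rewrite (iidE_ext _ _ _ _ (fun c => rsum nv (fun v => qV v * w (c i) v)
                                       * rsum nv (fun v => qV v * w (c i') v))).
  2:{ intros c; rewrite (iidE_two qV nv qV_sum n2 j j' (fun v v' => w (c i) v * w (c i') v'))
        by auto.
      rewrite <- rsum_scalr; apply rsum_ext; intros v _.
      rewrite Rmult_assoc; f_equal; rewrite <- rsum_scal; apply rsum_ext; intros v' _; ring. }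
  rewrite (iidE_two qU nu qU_sum n1 i i' (fun u u' => rsum nv (fun v => qV v * w u v)
                                       * rsum nv (fun v => qV v * w u' v))) by auto.
  rewrite <- w_mean_row at 1; rewrite <- rsum_scalr; apply rsum_ext; intros u _.
  rewrite Rmult_assoc; f_equal.
  rewrite <- w_mean_row, <- rsum_scal; apply rsum_ext; intros u' _; ring.
Qed.

(** Given the shared codeword the two weights are independent, so the expectation is the mean of a
    squared row sum. Row sums lie in [[0, 1]], hence the square is at most the row sum itself, whose
    mean is [g]. *)
Lemma w_pair_same_left i j j' :
  (i < n1)%nat -> (j < n2)%nat -> (j' < n2)%nat -> j <> j' ->
  iidE2 (fun c c' => w (c i) (c' j) * w (c i) (c' j')) <= g.
Proof.
  intros Hi Hj Hj' Hjj.
  rewrite (iidE2_right i j j' (fun u v v' => w u v * w u v')) by auto.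
  apply Rle_trans with (rsum nu (fun u => qU u *
    (rsum nv (fun v => qV v * w u v) * rsum nv (fun v => qV v * w u v)))).
  - apply Req_le.
    transitivity (rsum nv (fun v' => rsum nu (fun u =>
      qU u * rsum nv (fun v => qV v * w u v) * (qV v' * w u v')))).
    + apply rsum_ext; intros v' _; rewrite <- rsum_scal; apply rsum_ext; intros u _.
      rewrite <- !rsum_scal, <- rsum_scalr; apply rsum_ext; intros v _; ring.
    + rewrite rsum_swap; apply rsum_ext; intros u _.
      rewrite rsum_scal; ring.
  - rewrite <- w_mean_row; apply rsum_square_le; auto; intros u Hu; split; auto.
    apply rsum_nonneg; intros v Hv; apply Rmult_le_pos; auto.
Qed.

Lemma w_pair_same_right i i' j :
  (i < n1)%nat -> (i' < n1)%nat -> (j < n2)%nat -> i <> i' ->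
  iidE2 (fun c c' => w (c i) (c' j) * w (c i') (c' j)) <= g.
Proof.
  intros Hi Hi' Hj Hii.
  rewrite (iidE2_left i i' j (fun u u' v => w u v * w u' v)) by auto.
  apply Rle_trans with (rsum nv (fun v => qV v *
    (rsum nu (fun u => qU u * w u v) * rsum nu (fun u => qU u * w u v)))).
  - apply Req_le.
    transitivity (rsum nu (fun u' => rsum nv (fun v =>
      qV v * rsum nu (fun u => qU u * w u v) * (qU u' * w u' v)))).
    + apply rsum_ext; intros u' _; rewrite rsum_swap, <- rsum_scal.
      apply rsum_ext; intros v _.
      rewrite <- !rsum_scal, <- rsum_scalr; apply rsum_ext; intros u _; ring.
    + rewrite rsum_swap; apply rsum_ext; intros v _.
      rewrite rsum_scal; ring.
  - rewrite <- w_mean_col; apply rsum_square_le; auto; intros v Hv; split; auto.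
    apply rsum_nonneg; intros u Hu; apply Rmult_le_pos; auto.
Qed.

Lemma w_pair_same i j :
  (i < n1)%nat -> (j < n2)%nat ->
  iidE2 (fun c c' => w (c i) (c' j) * w (c i) (c' j)) <= Lam * g.
Proof.
  intros Hi Hj; rewrite (iidE2_one i j (fun u v => w u v * w u v)) by auto.
  rewrite <- w_mean, <- rsum_scal; apply rsum_le; intros u Hu.
  rewrite <- rsum_scal; apply rsum_le; intros v Hv.
  replace (qU u * qV v * (w u v * w u v)) with (w u v * (qU u * qV v * w u v)) by ring.
  apply Rmult_le_compat_r; [|auto].
  repeat apply Rmult_le_pos; auto.
Qed.

Lemma w_mean_nonneg : 0 <= g.
Proof.
  rewrite <- w_mean_row; apply rsum_nonneg; intros u Hu; apply Rmult_le_pos; auto.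
  apply rsum_nonneg; intros v Hv; apply Rmult_le_pos; auto.
Qed.

(** One formula for all four patterns of coincidence, so that summing over a bin only meets
    Kronecker deltas; where several deltas fire the surplus terms are nonnegative. *)
Lemma w_pair_bound i i' j j' :
  (i < n1)%nat -> (i' < n1)%nat -> (j < n2)%nat -> (j' < n2)%nat -> 0 <= Lam ->
  iidE2 (fun c c' => w (c i) (c' j) * w (c i') (c' j'))
  <= g * g + (if Nat.eqb i i' then g else 0)
     + ((if Nat.eqb j j' then g else 0)
        + (if Nat.eqb i i' then if Nat.eqb j j' then Lam * g else 0 else 0)).
Proof.
  intros Hi Hi' Hj Hj' HL.
  assert (Hg := w_mean_nonneg). assert (0 <= Lam * g) by now apply Rmult_le_pos.
  assert (0 <= g * g) by now apply Rmult_le_pos.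
  destruct (Nat.eqb_spec i i') as [<-|Hii]; destruct (Nat.eqb_spec j j') as [<-|Hjj].
  - assert (H1 := w_pair_same i j Hi Hj); lra.
  - assert (H1 := w_pair_same_left i j j' Hi Hj Hj' Hjj); lra.
  - assert (H1 := w_pair_same_right i i' j Hi Hi' Hj Hii); lra.
  - rewrite w_pair_distinct by auto; lra.
Qed.

Definition bin_weight (a b K L : nat) (c c' : nat -> nat) : R :=
  rsum K (fun k => rsum L (fun l => w (c (a + k)%nat) (c' (b + l)%nat))).

(** For a fixed pair of the bin, [L] pairs share its first codeword, [K] share its second and one
    coincides with it. They contribute [L g], [K g] and [Lam g] beyond the product [g * g] of the
    means. *)
Lemma bin_weight_variance a b K L :
  (a + K <= n1)%nat -> (b + L <= n2)%nat -> 0 <= Lam ->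
  let mu := INR K * INR L * g in
  iidE2 (fun c c' => (bin_weight a b K L c c' - mu) * (bin_weight a b K L c c' - mu))
  <= mu * (Lam + INR K + INR L).
Proof.
  intros HK HL HLam mu.
  assert (Hmean : iidE2 (bin_weight a b K L) = mu).
  { unfold bin_weight; rewrite iidE2_rsum.
    rewrite (rsum_ext K _ (fun _ => INR L * g)); [rewrite rsum_const; unfold mu; ring|].
    intros k Hk; rewrite iidE2_rsum, (rsum_ext L _ (fun _ => g)); [apply rsum_const|].
    intros l Hl; rewrite (iidE2_one (a + k) (b + l) w) by lia; exact w_mean. }
  assert (Hsq : iidE2 (fun c c' => bin_weight a b K L c c' * bin_weight a b K L c c')
                <= INR K * (INR L * (INR K * (INR L * (g * g)) + INR L * g
                                     + INR K * g + Lam * g))).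
  { rewrite (iidE2_ext _ (fun c c' => rsum K (fun k => rsum L (fun l =>
      rsum K (fun k' => rsum L (fun l' =>
        w (c (a + k)%nat) (c' (b + l)%nat) * w (c (a + k')%nat) (c' (b + l')%nat))))))).
    2:{ intros c c'; unfold bin_weight at 1; rewrite <- rsum_scalr.
        apply rsum_ext; intros k _; rewrite <- rsum_scalr.
        apply rsum_ext; intros l _; unfold bin_weight; rewrite <- rsum_scal.
        apply rsum_ext; intros k' _; now rewrite <- rsum_scal. }
    rewrite <- rsum_const, iidE2_rsum; apply rsum_le; intros k Hk.
    rewrite <- rsum_const, iidE2_rsum; apply rsum_le; intros l Hl.
    rewrite iidE2_rsum.
    apply Rle_trans with (rsum K (fun k' => (INR L * (g * g) + g)
       + (if Nat.eqb k k' then INR L * g + Lam * g else 0))).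
    2:{ rewrite rsum_plus, rsum_const, rsum_eqb by auto; lra. }
    apply rsum_le; intros k' Hk'; rewrite iidE2_rsum.
    apply Rle_trans with (rsum L (fun l' => (g * g + (if Nat.eqb k k' then g else 0))
        + (if Nat.eqb l l' then g + (if Nat.eqb k k' then Lam * g else 0) else 0))).
    - apply rsum_le; intros l' Hl'.
      assert (H := w_pair_bound (a + k) (a + k') (b + l) (b + l')
                     ltac:(lia) ltac:(lia) ltac:(lia) ltac:(lia) HLam).
      replace (Nat.eqb (a + k) (a + k')) with (Nat.eqb k k') in H
        by (destruct (Nat.eqb_spec k k'), (Nat.eqb_spec (a + k) (a + k')); lia || auto).
      replace (Nat.eqb (b + l) (b + l')) with (Nat.eqb l l') in H
        by (destruct (Nat.eqb_spec l l'), (Nat.eqb_spec (b + l) (b + l')); lia || auto).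
      destruct (Nat.eqb k k'), (Nat.eqb l l'); lra.
    - rewrite rsum_plus, rsum_const, rsum_eqb by auto.
      destruct (Nat.eqb k k'); lra. }
  rewrite (iidE2_ext _ (fun c c' => bin_weight a b K L c c' * bin_weight a b K L c c'
             + ((- 2 * mu) * bin_weight a b K L c c' + mu * mu))) by (intros; ring).
  rewrite !iidE2_plus, iidE2_scal, iidE2_const, Hmean.
  unfold mu in *; nra.
Qed.

End TwoCodebooks.

(** * Random coding *)

Section RandomCode.
Context (nu nv : nat) (p : nat -> nat -> R) (G : nat -> nat -> bool).
Context (p_nonneg : forall u v, 0 <= p u v).
Context (p_sum : rsum nu (fun u => rsum nv (fun v => p u v)) = 1).

Lemma pU_nonneg u : 0 <= pU nv p u.
Proof. apply rsum_nonneg; auto. Qed.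

Lemma pV_nonneg v : 0 <= pV nu p v.
Proof. apply rsum_nonneg; auto. Qed.

Lemma pV_sum : rsum nv (pV nu p) = 1.
Proof. rewrite <- p_sum, rsum_swap; reflexivity. Qed.

Lemma p_pos_marginals u v :
  (u < nu)%nat -> (v < nv)%nat -> 0 < p u v -> 0 < pU nv p u * pV nu p v.
Proof.
  intros Hu Hv Hp; apply Rmult_lt_0_compat; apply Rlt_le_trans with (1 := Hp).
  - apply (rsum_ge_term nv (fun v => p u v)); auto.
  - apply (rsum_ge_term nu (fun u => p u v)); auto.
Qed.

Definition weight (u v : nat) : R :=
  if G u v then p u v / (pU nv p u * pV nu p v) else 0.

(** A vanishing marginal forces [p u v = 0], so the quotient by zero in [weight] does no harm. *)
Lemma weight_spec u v :
  (u < nu)%nat -> (v < nv)%nat ->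
  pU nv p u * pV nu p v * weight u v = if G u v then p u v else 0.
Proof.
  intros Hu Hv; unfold weight; destruct (G u v); [|ring].
  destruct (Req_dec (p u v) 0) as [E|E].
  - rewrite E; unfold Rdiv; ring.
  - assert (0 < pU nv p u * pV nu p v).
    { apply p_pos_marginals; auto. destruct (p_nonneg u v); [auto|congruence]. }
    field; split; intros H0; rewrite H0 in *; lra.
Qed.

Lemma weight_nonneg u v : (u < nu)%nat -> (v < nv)%nat -> 0 <= weight u v.
Proof.
  intros Hu Hv; unfold weight; destruct (G u v); [|lra].
  destruct (p_nonneg u v) as [Hp|Hp].
  - apply Rlt_le, Rdiv_lt_0_compat; auto; now apply p_pos_marginals.
  - rewrite <- Hp; unfold Rdiv; lra.
Qed.

Lemma weight_le Lam u v :
  0 <= Lam -> (u < nu)%nat -> (v < nv)%nat ->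
  (G u v = true -> p u v <= Lam * (pU nv p u * pV nu p v)) -> weight u v <= Lam.
Proof.
  intros HL Hu Hv H; unfold weight; destruct (G u v); [|auto].
  destruct (p_nonneg u v) as [Hp|Hp].
  - assert (Hq := p_pos_marginals u v Hu Hv Hp).
    apply Rmult_le_reg_r with (1 := Hq); unfold Rdiv.
    rewrite Rmult_assoc, Rinv_l, Rmult_1_r by lra; auto.
  - rewrite <- Hp; unfold Rdiv; lra.
Qed.

(** The row sum is the conditional probability of [G] given [u]; if [pU u = 0], the whole row of
    weights is 0. *)
Lemma weight_row u :
  (u < nu)%nat -> rsum nv (fun v => pV nu p v * weight u v) <= 1.
Proof.
  intros Hu; destruct (pU_nonneg u) as [Hq|Hq].
  - apply Rmult_le_reg_l with (1 := Hq); rewrite <- rsum_scal, Rmult_1_r.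
    apply rsum_le; intros v Hv; rewrite <- Rmult_assoc, weight_spec by auto.
    destruct (G u v); [lra|auto].
  - rewrite (rsum_ext nv _ (fun _ => 0)), rsum_const; [lra|].
    intros v Hv; unfold weight; destruct (G u v); [|ring].
    assert (p u v <= pU nv p u) by (apply (rsum_ge_term nv (fun v => p u v)); auto).
    assert (E : p u v = 0) by (specialize (p_nonneg u v); lra).
    rewrite E; unfold Rdiv; ring.
Qed.

Lemma weight_col v :
  (v < nv)%nat -> rsum nu (fun u => pU nv p u * weight u v) <= 1.
Proof.
  intros Hv; destruct (pV_nonneg v) as [Hq|Hq].
  - apply Rmult_le_reg_l with (1 := Hq); rewrite <- rsum_scal, Rmult_1_r.
    apply rsum_le; intros u Hu.
    replace (pV nu p v * (pU nv p u * weight u v))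
      with (pU nv p u * pV nu p v * weight u v) by ring.
    rewrite weight_spec by auto.
    destruct (G u v); [lra|auto].
  - rewrite (rsum_ext nu _ (fun _ => 0)), rsum_const; [lra|].
    intros u Hu; unfold weight; destruct (G u v); [|ring].
    assert (p u v <= pV nu p v) by (apply (rsum_ge_term nu (fun u => p u v)); auto).
    assert (E : p u v = 0) by (specialize (p_nonneg u v); lra).
    rewrite E; unfold Rdiv; ring.
Qed.

Lemma weight_mean :
  rsum nu (fun u => rsum nv (fun v => pU nv p u * pV nu p v * weight u v)) = probG nu nv p G.
Proof.
  apply rsum_ext; intros u Hu; apply rsum_ext; intros v Hv; now apply weight_spec.
Qed.

(* Reweighting by [weight] turns the product law into [p] restricted to [G]. *)
Lemma weight_change_of_measure h :
  (forall u v, (u < nu)%nat -> (v < nv)%nat -> 0 <= h u v) ->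
  rsum nu (fun u => rsum nv (fun v => pU nv p u * pV nu p v * (weight u v * h u v)))
  <= rsum nu (fun u => rsum nv (fun v => p u v * h u v)).
Proof.
  intros Hh; apply rsum_le; intros u Hu; apply rsum_le; intros v Hv.
  rewrite <- Rmult_assoc, weight_spec by auto.
  apply Rmult_le_compat_r; auto.
  destruct (G u v); [lra|auto].
Qed.

(** * Expected cost of a fixed pair of codewords *)

Context (alpha beta : nat -> nat -> nat -> R) (tB tC e0 : R).
Context (alpha_range : forall u' u v, (u' < nu)%nat -> (u < nu)%nat -> (v < nv)%nat ->
                       0 <= alpha u' u v <= 1).
Context (beta_range : forall v' u v, (v' < nv)%nat -> (u < nu)%nat -> (v < nv)%nat ->
                      0 <= beta v' u v <= 1).
Context (alpha_miss :
  rsum nu (fun u => rsum nv (fun v => p u v * (1 - alpha u u v))) <= e0).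
Context (beta_miss :
  rsum nu (fun u => rsum nv (fun v => p u v * (1 - beta v u v))) <= e0).
Context (alpha_false : rsum nu (fun u' => pU nv p u' *
  rsum nu (fun u => rsum nv (fun v => p u v * alpha u' u v))) <= tB).
Context (beta_false : rsum nv (fun v' => pV nu p v' *
  rsum nu (fun u => rsum nv (fun v => p u v * beta v' u v))) <= tC).

(** Here [alpha u' u v] stands for the probability that the test of [u'] accepts the first
    receiver's output for [(u, v)], and [beta] likewise for the second. Only competitors tested
    before the true codeword occur, since a decoder stops at its first success; the factor 4 is that
    of the union bound. *)
Definition cost (c c' : nat -> nat) (i j : nat) : R :=
  4 * ((1 - alpha (c i) (c i) (c' j)) + rsum i (fun i' => alpha (c i') (c i) (c' j)))
  + 4 * ((1 - beta (c' j) (c i) (c' j)) + rsum j (fun j' => beta (c' j') (c i) (c' j))).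

Lemma cost_nonneg c c' i j :
  (forall i, (c i < nu)%nat) -> (forall j, (c' j < nv)%nat) -> 0 <= cost c c' i j.
Proof.
  intros Hc Hc'; unfold cost.
  assert (0 <= rsum i (fun i' => alpha (c i') (c i) (c' j)))
    by (apply rsum_nonneg; intros; apply alpha_range; auto).
  assert (0 <= rsum j (fun j' => beta (c' j') (c i) (c' j)))
    by (apply rsum_nonneg; intros; apply beta_range; auto).
  destruct (alpha_range (c i) (c i) (c' j)); auto.
  destruct (beta_range (c' j) (c i) (c' j)); auto.
  lra.
Qed.

(** The weight involves the transmitted letters only. It turns their product law into at most [p],
    while every earlier codeword keeps its marginal law; missed detections then meet [alpha_miss]
    and [beta_miss], false alarms [alpha_false] and [beta_false]. *)
Lemma expected_cost n1 n2 i j :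
  (i < n1)%nat -> (j < n2)%nat ->
  iidE2 (pU nv p) (pV nu p) nu nv n1 n2
    (fun c c' => weight (c i) (c' j) * cost c c' i j)
  <= 4 * (e0 + INR i * tB) + 4 * (e0 + INR j * tC).
Proof.
  intros Hi Hj.
  assert (HqU : rsum nu (pU nv p) = 1) by exact p_sum.
  assert (HqV := pV_sum).
  rewrite (iidE2_ext _ _ _ _ _ _ _ (fun c c' =>
    4 * (weight (c i) (c' j) * (1 - alpha (c i) (c i) (c' j))
         + rsum i (fun i' => weight (c i) (c' j) * alpha (c i') (c i) (c' j)))
    + 4 * (weight (c i) (c' j) * (1 - beta (c' j) (c i) (c' j))
         + rsum j (fun j' => weight (c i) (c' j) * beta (c' j') (c i) (c' j)))))
    by (intros c c'; unfold cost; rewrite !rsum_scal; ring).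
  rewrite iidE2_plus, !iidE2_scal, !iidE2_plus, !iidE2_rsum by auto.
  apply Rplus_le_compat; (apply Rmult_le_compat_l; [lra|]); apply Rplus_le_compat.
  - rewrite (iidE2_one _ _ _ _ _ _ HqU HqV i j
               (fun u v => weight u v * (1 - alpha u u v))) by auto.
    apply Rle_trans with (2 := alpha_miss); apply weight_change_of_measure.
    intros u v Hu Hv; destruct (alpha_range u u v); auto; lra.
  - rewrite <- rsum_const; apply rsum_le; intros i' Hi'.
    rewrite (iidE2_left _ _ _ _ _ _ HqU HqV i i' j
               (fun u u' v => weight u v * alpha u' u v)) by (auto; lia).
    apply Rle_trans with (2 := alpha_false); apply rsum_le; intros u' Hu'.
    apply Rmult_le_compat_l; [apply pU_nonneg|].
    apply weight_change_of_measure; intros; apply alpha_range; auto.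
  - rewrite (iidE2_one _ _ _ _ _ _ HqU HqV i j
               (fun u v => weight u v * (1 - beta v u v))) by auto.
    apply Rle_trans with (2 := beta_miss); apply weight_change_of_measure.
    intros u v Hu Hv; destruct (beta_range v u v); auto; lra.
  - rewrite <- rsum_const; apply rsum_le; intros j' Hj'.
    rewrite (iidE2_right _ _ _ _ _ _ HqU HqV i j j'
               (fun u v v' => weight u v * beta v' u v)) by (auto; lia).
    apply Rle_trans with (2 := beta_false); apply rsum_le; intros v' Hv'.
    apply Rmult_le_compat_l; [apply pV_nonneg|].
    apply weight_change_of_measure; intros; apply beta_range; auto.
Qed.

(** * Choice of a pair within each bin *)

Context (Lam et : R) (M1 M2 K L : nat).
Context (G_prob : 3 / 4 <= probG nu nv p G) (Lam_nonneg : 0 <= Lam).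
Context (G_ratio : forall u v, (u < nu)%nat -> (v < nv)%nat -> G u v = true ->
                   p u v <= Lam * (pU nv p u * pV nu p v)).
Context (M1_pos : (1 <= M1)%nat) (M2_pos : (1 <= M2)%nat).
Context (K_pos : (1 <= K)%nat) (L_pos : (1 <= L)%nat).
Context (tB_nonneg : 0 <= tB) (tC_nonneg : 0 <= tC).
Context (B_size : INR M1 * INR K * tB <= et) (C_size : INR M2 * INR L * tC <= et).
Context (bin_size : Lam + INR K + INR L <= 2 * et * (INR K * INR L)).

Let mu := INR K * INR L * probG nu nv p G.

(* Chebyshev bound on the event that a bin has less than two thirds of its mean
   weight [mu], plus the average cost when its pairs are chosen in proportion to
   their weight. *)
Definition bin_cost_bound (m1 m2 : nat) (c c' : nat -> nat) : R :=
  9 / (mu * mu) * ((bin_weight weight (m1 * K) (m2 * L) K L c c' - mu)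
                   * (bin_weight weight (m1 * K) (m2 * L) K L c c' - mu))
  + 3 / (2 * mu) * rsum K (fun k => rsum L (fun l =>
      weight (c (m1 * K + k)%nat) (c' (m2 * L + l)%nat)
      * cost c c' (m1 * K + k) (m2 * L + l))).

Lemma mu_pos : 0 < mu.
Proof.
  unfold mu; assert (0 < INR K) by (apply lt_0_INR; lia).
  assert (0 < INR L) by (apply lt_0_INR; lia).
  repeat apply Rmult_lt_0_compat; lra.
Qed.

Lemma bin_index_lt m M k B : (m < M)%nat -> (k < B)%nat -> (m * B + k < M * B)%nat.
Proof. nia. Qed.

(** Write [g] for the probability of [G], so [mu = K L g] with [g >= 3/4]. The Chebyshev term is at
    most [9 / mu] times [2 et K L], that is [18 et / g <= 24 et]. The cost of a pair is on average
    at most [8 (e0 + et)], and the factor [3 / (2 mu)] turns this into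
    [12 (e0 + et) / g <= 16 (e0 + et)]. *)
Lemma expected_bin_cost m1 m2 :
  (m1 < M1)%nat -> (m2 < M2)%nat ->
  iidE2 (pU nv p) (pV nu p) nu nv (M1 * K) (M2 * L) (bin_cost_bound m1 m2)
  <= 16 * e0 + 40 * et.
Proof.
  intros Hm1 Hm2; unfold bin_cost_bound.
  assert (Hmu := mu_pos).
  assert (HK : 0 < INR K) by (apply lt_0_INR; lia).
  assert (HL : 0 < INR L) by (apply lt_0_INR; lia).
  rewrite iidE2_plus, !iidE2_scal.
  assert (HqU : rsum nu (pU nv p) = 1) by exact p_sum.
  assert (HqV := pV_sum).
  assert (Hvar := bin_weight_variance (pU nv p) (pV nu p) nu nv (M1 * K) (M2 * L)
    (fun u _ => pU_nonneg u) HqU (fun v _ => pV_nonneg v) HqV weight Lam _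
    weight_nonneg (fun u v Hu Hv => weight_le Lam u v Lam_nonneg Hu Hv (G_ratio u v Hu Hv))
    weight_row weight_col weight_mean (m1 * K) (m2 * L) K L
    ltac:(nia) ltac:(nia) Lam_nonneg).
  cbv zeta in Hvar; fold mu in Hvar.
  assert (Hsum : iidE2 (pU nv p) (pV nu p) nu nv (M1 * K) (M2 * L)
     (fun c c' => rsum K (fun k => rsum L (fun l =>
        weight (c (m1 * K + k)%nat) (c' (m2 * L + l)%nat)
        * cost c c' (m1 * K + k) (m2 * L + l)))) <= INR K * (INR L * (8 * e0 + 8 * et))).
  { rewrite iidE2_rsum by auto; rewrite <- rsum_const; apply rsum_le; intros k Hk.
    rewrite iidE2_rsum by auto; rewrite <- rsum_const; apply rsum_le; intros l Hl.
    assert (Hi := bin_index_lt m1 M1 k K Hm1 Hk).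
    assert (Hj := bin_index_lt m2 M2 l L Hm2 Hl).
    apply Rle_trans with (1 := expected_cost (M1 * K) (M2 * L) _ _ Hi Hj).
    apply lt_INR in Hi; apply lt_INR in Hj; rewrite mult_INR in Hi, Hj.
    (* At most a whole codebook of competitors precedes the transmitted codeword. *)
    assert (INR (m1 * K + k) * tB <= INR M1 * INR K * tB)
      by (apply Rmult_le_compat_r; lra).
    assert (INR (m2 * L + l) * tC <= INR M2 * INR L * tC)
      by (apply Rmult_le_compat_r; lra).
    lra. }
  assert (He0 : 0 <= e0).
  { apply Rle_trans with (2 := alpha_miss).
    apply rsum_nonneg; intros u Hu; apply rsum_nonneg; intros v Hv.
    apply Rmult_le_pos; auto. destruct (alpha_range u u v); auto; lra. }
  assert (Het : 0 <= et).
  { apply Rle_trans with (2 := B_size); repeat apply Rmult_le_pos; auto; apply pos_INR. }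
  set (g := probG nu nv p G) in *.
  apply Rle_trans with (24 * et + 16 * (e0 + et)); [|lra].
  apply Rplus_le_compat.
  - apply Rle_trans with (9 / (mu * mu) * (mu * (2 * et * (INR K * INR L)))).
    + apply Rmult_le_compat_l.
      * apply Rlt_le, Rdiv_lt_0_compat; [lra|now apply Rmult_lt_0_compat].
      * apply Rle_trans with (1 := Hvar); apply Rmult_le_compat_l; lra.
    + apply Rmult_le_reg_r with g; [lra|].
      replace (9 / (mu * mu) * (mu * (2 * et * (INR K * INR L))) * g) with (18 * et)
        by (unfold mu; field; unfold mu in *; repeat split; nra).
      assert (et * (3 / 4) <= et * g) by (apply Rmult_le_compat_l; auto); lra.
  - apply Rle_trans with (3 / (2 * mu) * (INR K * (INR L * (8 * e0 + 8 * et)))).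
    + apply Rmult_le_compat_l; [|exact Hsum].
      apply Rlt_le, Rdiv_lt_0_compat; lra.
    + apply Rmult_le_reg_r with g; [lra|].
      replace (3 / (2 * mu) * (INR K * (INR L * (8 * e0 + 8 * et))) * g)
        with (12 * (e0 + et))
        by (unfold mu; field; unfold mu in *; repeat split; nra).
      assert ((e0 + et) * (3 / 4) <= (e0 + et) * g) by (apply Rmult_le_compat_l; lra); lra.
Qed.

(** A pointwise form of Chebyshev's inequality, in which no event has to be formed. If the bin
    weight [N] is at least [2 mu / 3], then [1 / N <= 3 / (2 mu)] and the minimum is below the
    weighted average. Otherwise [(N - mu)^2 > mu^2 / 9], so the quadratic term alone exceeds 1,
    which bounds the truncated cost. *)
Lemma best_pair m1 m2 c c' :
  (forall i, (c i < nu)%nat) -> (forall j, (c' j < nv)%nat) ->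
  exists k l, (k < K)%nat /\ (l < L)%nat /\
    Rmin 1 (cost c c' (m1 * K + k) (m2 * L + l)) <= bin_cost_bound m1 m2 c c'.
Proof.
  intros Hc Hc'.
  (* A pair [(k, l)] is coded as the single number [q = k L + l], so that one [argmin] ranges over
     the bin. *)
  set (e := fun q => Rmin 1 (cost c c' (m1 * K + q / L) (m2 * L + q mod L))).
  set (wq := fun q => weight (c (m1 * K + q / L)%nat) (c' (m2 * L + q mod L)%nat)).
  set (q := argmin (K * L) e).
  assert (Hq : (q < K * L)%nat) by (apply argmin_lt; nia).
  exists (q / L)%nat, (q mod L)%nat.
  split; [apply Nat.Div0.div_lt_upper_bound; lia|].
  split; [apply Nat.mod_upper_bound; lia|].
  assert (Hreindex : forall h : nat -> nat -> R,
    rsum (K * L) (fun q => h (q / L)%nat (q mod L)%nat)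
    = rsum K (fun k => rsum L (fun l => h k l))).
  { intros h; rewrite rsum_mul_index; apply rsum_ext; intros k _.
    apply rsum_ext; intros l Hl; f_equal.
    - rewrite Nat.div_add_l, Nat.div_small by lia; lia.
    - rewrite Nat.add_comm, Nat.Div0.mod_add, Nat.mod_small by lia; lia. }
  assert (Hmu := mu_pos).
  change (e q <= bin_cost_bound m1 m2 c c'); unfold bin_cost_bound.
  set (N := bin_weight weight (m1 * K) (m2 * L) K L c c').
  set (S := rsum K (fun k => rsum L _)).
  assert (HwS : 0 <= S).
  { apply rsum_nonneg; intros k _; apply rsum_nonneg; intros l _.
    apply Rmult_le_pos; [now apply weight_nonneg|now apply cost_nonneg]. }
  assert (Hinv : 0 < 3 / (2 * mu)) by (apply Rdiv_lt_0_compat; lra).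
  assert (Hinv2 : 0 < 9 / (mu * mu)) by (apply Rdiv_lt_0_compat; [|apply Rmult_lt_0_compat]; lra).
  assert (Hcheb : 0 <= 9 / (mu * mu) * ((N - mu) * (N - mu)))
    by (apply Rmult_le_pos; [now apply Rlt_le|apply Rle_0_sqr]).
  assert (HS : 0 <= 3 / (2 * mu) * S) by (apply Rmult_le_pos; lra).
  destruct (Rle_or_lt (2 / 3 * mu) N) as [HN|HN].
  - assert (Heq : e q * N <= S).
    { assert (H := argmin_le_average (K * L) wq e (fun q _ => weight_nonneg _ _ (Hc _) (Hc' _))).
      fold q in H.
      replace (rsum (K * L) wq) with N in H
        by (symmetry; apply (Hreindex (fun k l => weight (c (m1 * K + k)%nat) (c' (m2 * L + l)%nat)))).
      apply Rle_trans with (1 := H).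
      apply Rle_trans with (rsum (K * L) (fun q => wq q * cost c c' (m1 * K + q / L) (m2 * L + q mod L))).
      - apply rsum_le; intros r _; apply Rmult_le_compat_l;
          [now apply weight_nonneg|apply Rmin_r].
      - apply Req_le, (Hreindex (fun k l => weight (c (m1 * K + k)%nat) (c' (m2 * L + l)%nat)
                                 * cost c c' (m1 * K + k) (m2 * L + l))). }
    assert (He : 0 <= e q).
    { unfold e; apply Rmin_glb; [lra|now apply cost_nonneg]. }
    assert (Hle : e q <= 3 / (2 * mu) * S).
    { apply Rmult_le_reg_r with (2 / 3 * mu); [lra|].
      replace (3 / (2 * mu) * S * (2 / 3 * mu)) with S by (field; lra).
      nra. }
    lra.
  - assert (He : e q <= 1) by apply Rmin_l.
    assert (Hge : 1 <= 9 / (mu * mu) * ((N - mu) * (N - mu))).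
    { apply Rmult_le_reg_r with (mu * mu); [now apply Rmult_lt_0_compat|].
      replace (9 / (mu * mu) * ((N - mu) * (N - mu)) * (mu * mu))
        with (9 * ((N - mu) * (N - mu))) by (field; lra).
      nra. }
    lra.
Qed.

Lemma good_code :
  exists (c c' : nat -> nat) (kk ll : nat -> nat -> nat),
    (forall i, (c i < nu)%nat) /\ (forall j, (c' j < nv)%nat) /\
    (forall m1 m2, (kk m1 m2 < K)%nat /\ (ll m1 m2 < L)%nat) /\
    rsum M1 (fun m1 => rsum M2 (fun m2 =>
      Rmin 1 (cost c c' (m1 * K + kk m1 m2) (m2 * L + ll m1 m2))))
    <= INR M1 * INR M2 * (16 * e0 + 40 * et).
Proof.
  assert (HqU : rsum nu (pU nv p) = 1) by exact p_sum.
  assert (HqV := pV_sum).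
  destruct (iidE2_attained (pU nv p) (pV nu p) nu nv (M1 * K) (M2 * L)
    (fun u _ => pU_nonneg u) HqU (fun v _ => pV_nonneg v) HqV
    (fun c c' => rsum M1 (fun m1 => rsum M2 (fun m2 => bin_cost_bound m1 m2 c c'))))
    as [c [c' [Hc [Hc' Hle]]]].
  (* The pairs are given by existence statements only, so the encoder is a choice function. *)
  assert (Hch : forall m1 m2, {kl : nat * nat | (fst kl < K)%nat /\ (snd kl < L)%nat /\
    Rmin 1 (cost c c' (m1 * K + fst kl) (m2 * L + snd kl)) <= bin_cost_bound m1 m2 c c'}).
  { intros m1 m2; apply constructive_indefinite_description.
    destruct (best_pair m1 m2 c c' Hc Hc') as [k [l H]]; exists (k, l); exact H. }
  exists c, c', (fun m1 m2 => fst (proj1_sig (Hch m1 m2))),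
    (fun m1 m2 => snd (proj1_sig (Hch m1 m2))).
  split; [auto|]. split; [auto|]. split.
  { intros m1 m2; destruct (proj2_sig (Hch m1 m2)) as [? [? _]]; auto. }
  apply Rle_trans with (rsum M1 (fun m1 => rsum M2 (fun m2 => bin_cost_bound m1 m2 c c'))).
  - apply rsum_le; intros m1 _; apply rsum_le; intros m2 _.
    apply (proj2_sig (Hch m1 m2)).
  - apply Rle_trans with (1 := Hle).
    rewrite iidE2_rsum, Rmult_assoc, <- rsum_const by auto; apply rsum_le; intros m1 Hm1.
    rewrite iidE2_rsum, <- rsum_const by auto; apply rsum_le; intros m2 Hm2.
    now apply expected_bin_cost.
Qed.

End RandomCode.

(** * Complex sums and quadratic forms *)

Lemma C_eq a b : re a = re b -> im a = im b -> a = b.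
Proof. destruct a, b; simpl; congruence. Qed.

Lemma C_ring_theory :
  ring_theory C0 C1 Cadd Cmul (fun a b => Cadd a (Copp b)) Copp eq.
Proof. constructor; intros; apply C_eq; simpl; ring. Qed.

Add Ring C_ring : C_ring_theory.

Lemma Cconj_add a b : Cconj (Cadd a b) = Cadd (Cconj a) (Cconj b).
Proof. apply C_eq; simpl; ring. Qed.

Lemma Cconj_mul a b : Cconj (Cmul a b) = Cmul (Cconj a) (Cconj b).
Proof. apply C_eq; simpl; ring. Qed.

Lemma Cconj_opp a : Cconj (Copp a) = Copp (Cconj a).
Proof. apply C_eq; simpl; ring. Qed.

Lemma Cconj_conj a : Cconj (Cconj a) = a.
Proof. apply C_eq; simpl; ring. Qed.

Lemma Cscale_mul r a : Cscale r a = Cmul (mkC r 0) a.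
Proof. apply C_eq; simpl; ring. Qed.

Lemma csum_ext n f g : (forall k, (k < n)%nat -> f k = g k) -> csum n f = csum n g.
Proof.
  induction n as [|n IH]; intros H; simpl; [reflexivity|].
  rewrite IH, H by auto; reflexivity.
Qed.

Lemma csum_add n f g : csum n (fun k => Cadd (f k) (g k)) = Cadd (csum n f) (csum n g).
Proof. induction n as [|n IH]; simpl; [|rewrite IH]; ring. Qed.

Lemma csum_opp n f : csum n (fun k => Copp (f k)) = Copp (csum n f).
Proof. induction n as [|n IH]; simpl; [|rewrite IH]; ring. Qed.

Lemma csum_mul_l n a f : csum n (fun k => Cmul a (f k)) = Cmul a (csum n f).
Proof. induction n as [|n IH]; simpl; [|rewrite IH]; ring. Qed.

Lemma csum_mul_r n a f : csum n (fun k => Cmul (f k) a) = Cmul (csum n f) a.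
Proof. induction n as [|n IH]; simpl; [|rewrite IH]; ring. Qed.

Lemma csum_0 n : csum n (fun _ => C0) = C0.
Proof. induction n as [|n IH]; simpl; [|rewrite IH]; ring. Qed.

Lemma csum_conj n f : csum n (fun k => Cconj (f k)) = Cconj (csum n f).
Proof.
  induction n as [|n IH]; simpl; [apply C_eq; simpl; ring|].
  now rewrite IH, Cconj_add.
Qed.

Lemma csum_swap n m f :
  csum n (fun i => csum m (fun j => f i j)) = csum m (fun j => csum n (fun i => f i j)).
Proof.
  induction n as [|n IH]; simpl; [now rewrite csum_0|].
  now rewrite IH, <- csum_add.
Qed.

Lemma csum_re n f : re (csum n f) = rsum n (fun k => re (f k)).
Proof. induction n as [|n IH]; simpl; [|rewrite IH]; reflexivity. Qed.

Lemma csum_delta n k f :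
  (k < n)%nat -> (forall i, (i < n)%nat -> i <> k -> f i = C0) -> csum n f = f k.
Proof.
  induction n as [|n IH]; intros Hk Hf; [lia|]; simpl.
  destruct (Nat.eq_dec k n) as [->|Hne].
  - rewrite (csum_ext n f (fun _ => C0)), csum_0; [ring|].
    intros i Hi; apply Hf; lia.
  - rewrite IH by (auto; lia); rewrite (Hf n) by lia; ring.
Qed.

Lemma csum_mul_index n d f :
  csum (n * d) f = csum n (fun a => csum d (fun b => f (a * d + b)%nat)).
Proof.
  assert (Hadd : forall m k, csum (m + k) f = Cadd (csum m f) (csum k (fun b => f (m + b)%nat))).
  { intros m k; induction k as [|k IH]; simpl.
    - rewrite Nat.add_0_r; ring.
    - rewrite Nat.add_succ_r; simpl; rewrite IH; ring. }
  induction n as [|n IH]; [reflexivity|].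
  simpl csum; rewrite Nat.add_comm, Hadd, IH; reflexivity.
Qed.

Definition cdot (d : nat) (x y : nat -> C) : C := csum d (fun i => Cmul (Cconj (x i)) (y i)).
Definition mv (d : nat) (A : Mat) (x : nat -> C) : nat -> C :=
  fun i => csum d (fun j => Cmul (A i j) (x j)).
Definition vsub (x y : nat -> C) : nat -> C := fun i => Cadd (x i) (Copp (y i)).
Definition vhalf (x : nat -> C) : nat -> C := fun i => Cscale (1 / 2) (x i).
Definition ip (d : nat) (x y : nat -> C) : R := re (cdot d x y).
Definition form (d : nat) (A : Mat) (x : nat -> C) : R := ip d x (mv d A x).
Definition effect (d : nat) (A : Mat) : Prop := psd d A /\ psd d (msub idm A).

Lemma psd_form d A x : psd d A -> 0 <= form d A x.
Proof. intros [_ H]; apply H. Qed.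

Lemma cdot_ext d x x' y y' :
  (forall i, (i < d)%nat -> x i = x' i) -> (forall i, (i < d)%nat -> y i = y' i) ->
  cdot d x y = cdot d x' y'.
Proof. intros Hx Hy; apply csum_ext; intros i Hi; now rewrite Hx, Hy. Qed.

Lemma ip_ext d x x' y y' :
  (forall i, (i < d)%nat -> x i = x' i) -> (forall i, (i < d)%nat -> y i = y' i) ->
  ip d x y = ip d x' y'.
Proof. intros Hx Hy; unfold ip; now rewrite (cdot_ext d x x' y y'). Qed.

Lemma mv_ext d A x y i : (forall j, (j < d)%nat -> x j = y j) -> mv d A x i = mv d A y i.
Proof. intros H; apply csum_ext; intros j Hj; now rewrite H. Qed.

Lemma cdot_conj d x y : cdot d x y = Cconj (cdot d y x).
Proof.
  unfold cdot; rewrite <- csum_conj; apply csum_ext; intros i _.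
  rewrite Cconj_mul, Cconj_conj; ring.
Qed.

Lemma ip_sym d x y : ip d x y = ip d y x.
Proof. unfold ip; rewrite cdot_conj; reflexivity. Qed.

Lemma ip_self_nonneg d x : 0 <= ip d x x.
Proof.
  unfold ip, cdot; rewrite csum_re; apply rsum_nonneg; intros i _; simpl.
  assert (H1 := Rle_0_sqr (re (x i))); assert (H2 := Rle_0_sqr (im (x i))).
  unfold Rsqr in *; lra.
Qed.

Lemma ip_sub_r d x y z : ip d x (vsub y z) = ip d x y - ip d x z.
Proof.
  unfold ip, cdot, vsub.
  rewrite (csum_ext d _ (fun i => Cadd (Cmul (Cconj (x i)) (y i)) (Copp (Cmul (Cconj (x i)) (z i)))))
    by (intros; ring).
  rewrite csum_add, csum_opp; reflexivity.
Qed.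

Lemma ip_sub_l d x y z : ip d (vsub x y) z = ip d x z - ip d y z.
Proof. rewrite !(ip_sym d _ z); apply ip_sub_r. Qed.

Lemma ip_half_r d x y : ip d x (vhalf y) = ip d x y / 2.
Proof.
  unfold ip, cdot; rewrite !csum_re; unfold Rdiv; rewrite <- rsum_scalr.
  apply rsum_ext; intros i _; simpl; field.
Qed.

Lemma ip_half_l d x y : ip d (vhalf x) y = ip d x y / 2.
Proof. rewrite !(ip_sym d _ y); apply ip_half_r. Qed.

Lemma mv_sub d A x y i : mv d A (vsub x y) i = vsub (mv d A x) (mv d A y) i.
Proof.
  unfold mv, vsub; rewrite <- csum_opp, <- csum_add; apply csum_ext; intros; ring.
Qed.

Lemma mv_half d A x i : mv d A (vhalf x) i = vhalf (mv d A x) i.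
Proof.
  unfold mv, vhalf; rewrite Cscale_mul, <- csum_mul_l; apply csum_ext; intros.
  rewrite Cscale_mul; ring.
Qed.

Lemma mv_idm d x i : (i < d)%nat -> mv d idm x i = x i.
Proof.
  intros Hi; unfold mv; rewrite (csum_delta d i); unfold idm; auto.
  - rewrite Nat.eqb_refl; ring.
  - intros j _ Hj; destruct (Nat.eqb_spec i j); [congruence|ring].
Qed.

Lemma mv_msub d A B x i : mv d (msub A B) x i = vsub (mv d A x) (mv d B x) i.
Proof.
  unfold mv, vsub, msub; rewrite <- csum_opp, <- csum_add; apply csum_ext; intros; ring.
Qed.

Lemma hermitian_cdot d A x y :
  hermitian d A -> cdot d x (mv d A y) = cdot d (mv d A x) y.
Proof.
  intros H; unfold cdot, mv.
  transitivity (csum d (fun i => csum d (fun j => Cmul (Cconj (x i)) (Cmul (A i j) (y j))))).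
  { apply csum_ext; intros i _; now rewrite csum_mul_l. }
  rewrite csum_swap; apply csum_ext; intros j Hj.
  rewrite <- csum_conj, <- csum_mul_r; apply csum_ext; intros i Hi.
  rewrite Cconj_mul, <- (H i j) by auto; ring.
Qed.

Lemma psd_symmetric d A x y : psd d A -> ip d x (mv d A y) = ip d (mv d A x) y.
Proof. intros [H _]; unfold ip; now rewrite hermitian_cdot. Qed.

Lemma form_msub d A B x : form d (msub A B) x = form d A x - form d B x.
Proof.
  unfold form; rewrite <- ip_sub_r; apply ip_ext; auto; intros; apply mv_msub.
Qed.

Lemma form_idm d x : form d idm x = ip d x x.
Proof. apply ip_ext; auto; intros; now apply mv_idm. Qed.

Lemma form_mscale d r A x : form d (mscale r A) x = r * form d A x.
Proof.
  unfold form, ip, cdot, mv; rewrite !csum_re, <- rsum_scal.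
  apply rsum_ext; intros i _.
  rewrite (csum_ext d _ (fun j => Cmul (mkC r 0) (Cmul (A i j) (x j))))
    by (intros; unfold mscale; rewrite Cscale_mul; ring).
  rewrite csum_mul_l; simpl; ring.
Qed.

Lemma form_msum d n F x : form d (msum n F) x = rsum n (fun k => form d (F k) x).
Proof.
  induction n as [|n IH]; simpl.
  - unfold form, ip, cdot, mv, msum; simpl; rewrite csum_re.
    rewrite (rsum_ext d _ (fun _ => 0)), rsum_const; [ring|]; intros i _.
    rewrite (csum_ext d _ (fun _ => C0)) by (intros; ring); rewrite csum_0; simpl; ring.
  - rewrite <- IH; unfold form, ip; change (re ?a + re ?b) with (re (Cadd a b)); f_equal.
    unfold cdot; rewrite <- csum_add; apply csum_ext; intros i _.
    transitivity (Cmul (Cconj (x i)) (Cadd (mv d (msum n F) x i) (mv d (F n) x i))); [|ring].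
    f_equal; unfold mv; rewrite <- csum_add; apply csum_ext; intros j _.
    unfold msum; simpl; ring.
Qed.

Lemma hermitian_idm d : hermitian d idm.
Proof.
  intros i j _ _; unfold idm; rewrite Nat.eqb_sym.
  destruct (Nat.eqb j i); apply C_eq; simpl; ring.
Qed.

Lemma hermitian_msub d A B : hermitian d A -> hermitian d B -> hermitian d (msub A B).
Proof.
  intros HA HB i j Hi Hj; unfold msub; now rewrite Cconj_add, Cconj_opp, <- HA, <- HB.
Qed.

Lemma hermitian_mscale d r A : hermitian d A -> hermitian d (mscale r A).
Proof.
  intros HA i j Hi Hj; unfold mscale; rewrite !Cscale_mul, Cconj_mul, <- HA by auto.
  f_equal; apply C_eq; simpl; ring.
Qed.

Lemma hermitian_msum d n F :
  (forall k, (k < n)%nat -> hermitian d (F k)) -> hermitian d (msum n F).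
Proof.
  intros HF i j Hi Hj; unfold msum; rewrite <- csum_conj; apply csum_ext; intros k Hk.
  now apply HF.
Qed.

Lemma psd_idm d : psd d idm.
Proof.
  split; [apply hermitian_idm|]; intros x; change (0 <= form d idm x).
  rewrite form_idm; apply ip_self_nonneg.
Qed.

Lemma effect_complement d A : effect d A -> effect d (msub idm A).
Proof.
  intros [HA HA']; split; [auto|]; split.
  - apply hermitian_msub; [apply hermitian_idm|apply HA'].
  - intros x; change (0 <= form d (msub idm (msub idm A)) x).
    rewrite !form_msub; assert (H := psd_form d A x HA); lra.
Qed.

Lemma mv_complement d A x i :
  (i < d)%nat -> mv d (msub idm A) x i = vsub x (mv d A x) i.
Proof. intros Hi; rewrite mv_msub; unfold vsub; now rewrite mv_idm. Qed.

(* [A - A^2 = A (I - A) A + (I - A) A (I - A)]. *)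
Lemma effect_square_le d A x : effect d A -> ip d (mv d A x) (mv d A x) <= form d A x.
Proof.
  intros [HA HA'].
  assert (H1 := psd_form d _ (mv d A x) HA').
  assert (H2 := psd_form d _ (vsub x (mv d A x)) HA).
  rewrite form_msub, form_idm in H1; unfold form in *.
  rewrite (ip_ext d _ _ _ (vsub (mv d A x) (mv d A (mv d A x)))
             (fun _ _ => eq_refl) (fun i _ => mv_sub d A _ _ i)) in H2.
  rewrite ip_sub_l, !ip_sub_r in H2.
  rewrite (psd_symmetric d A x (mv d A x) HA) in H2; lra.
Qed.

(** This is nonnegativity of the form at [x - y / 2]. The unequal split leaves coefficient 1 at [x],
    the fixed input, and only 1/4 at [y], which the loss of norm can absorb. *)
Lemma psd_cross_le d A x y :
  psd d A -> ip d x (mv d A y) <= form d A x + form d A y / 4.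
Proof.
  intros HA; assert (H := psd_form d _ (vsub x (vhalf y)) HA); unfold form in *.
  rewrite (ip_ext d _ _ _ (vsub (mv d A x) (vhalf (mv d A y)))
             (fun _ _ => eq_refl)) in H.
  2:{ intros i _; rewrite mv_sub; unfold vsub; now rewrite mv_half. }
  rewrite ip_sub_l, !ip_sub_r, !ip_half_l, !ip_half_r in H.
  rewrite (ip_sym d y (mv d A x)), <- (psd_symmetric d A x y HA) in H; lra.
Qed.

(** * Sequential measurements *)

Fixpoint seqv (d : nat) (D : nat -> Mat) (x : nat -> C) (n : nat) : nat -> C :=
  match n with
  | O => x
  | S k => vsub (seqv d D x k) (mv d (D k) (seqv d D x k))
  end.

Lemma seqv_step_norm d D x n :
  ip d (seqv d D x (S n)) (seqv d D x (S n))
  = ip d (seqv d D x n) (seqv d D x n) - 2 * form d (D n) (seqv d D x n)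
    + ip d (mv d (D n) (seqv d D x n)) (mv d (D n) (seqv d D x n)).
Proof.
  simpl; rewrite ip_sub_l, !ip_sub_r.
  rewrite (ip_sym d (mv d (D n) (seqv d D x n)) (seqv d D x n)); unfold form; lra.
Qed.

Lemma seqv_norm_decr d D x n k :
  (forall i, effect d (D i)) ->
  ip d (seqv d D x (n + k)) (seqv d D x (n + k)) <= ip d (seqv d D x n) (seqv d D x n).
Proof.
  intros HD; induction k as [|k IH]; [rewrite Nat.add_0_r; lra|].
  rewrite Nat.add_succ_r, seqv_step_norm.
  assert (H1 := effect_square_le d _ (seqv d D x (n + k)) (HD (n + k)%nat)).
  assert (H2 := psd_form d _ (seqv d D x (n + k)) (proj1 (HD (n + k)%nat))).
  lra.
Qed.

(* Gao's quantum union bound.  The bound on [<x,x> - <x,x_n>] is the quantity that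
   can be carried through the induction. *)
Lemma seqv_union_bound d D x n :
  (forall i, effect d (D i)) ->
  ip d x x - ip d (seqv d D x n) (seqv d D x n) <= 4 * rsum n (fun i => form d (D i) x).
Proof.
  intros HD.
  assert (Hinv : ip d x x - ip d x (seqv d D x n) <= rsum n (fun i => form d (D i) x)
            + (ip d x x - ip d (seqv d D x n) (seqv d D x n)) / 4).
  { induction n as [|n IH]; [simpl; lra|].
    rewrite seqv_step_norm; simpl rsum; simpl seqv; rewrite ip_sub_r.
    (* By this inequality step [n] lowers the squared norm by at least [form (D n)] at the current
       vector, a quarter of which pays for the last term of [psd_cross_le]. *)
    assert (H1 := effect_square_le d _ (seqv d D x n) (HD n)).
    assert (H2 := psd_cross_le d _ x (seqv d D x n) (proj1 (HD n))).
    lra. }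
  (* With [Delta] the total loss of squared norm, this gives [Delta / 2 <= <x,x> - <x,x_n>]. The
     invariant then reads [Delta / 2 <= sum + Delta / 4]. *)
  assert (H := ip_self_nonneg d (vsub x (seqv d D x n))).
  rewrite ip_sub_l, !ip_sub_r, (ip_sym d (seqv d D x n) x) in H; lra.
Qed.

Fixpoint seqm (d : nat) (D : nat -> Mat) (n : nat) : Mat :=
  match n with
  | O => idm
  | S k => msub (seqm d D k) (mmul d (D k) (seqm d D k))
  end.

Lemma mv_mmul d A B x i : mv d (mmul d A B) x i = mv d A (mv d B x) i.
Proof.
  unfold mv, mmul.
  transitivity (csum d (fun j => csum d (fun k => Cmul (Cmul (A i k) (B k j)) (x j)))).
  { apply csum_ext; intros j _; now rewrite csum_mul_r. }
  rewrite csum_swap; apply csum_ext; intros k _.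
  rewrite <- csum_mul_l; apply csum_ext; intros; ring.
Qed.

Lemma mv_seqm d D x n i : (i < d)%nat -> mv d (seqm d D n) x i = seqv d D x n i.
Proof.
  revert i; induction n as [|n IH]; intros i Hi; [now apply mv_idm|].
  simpl; rewrite mv_msub; unfold vsub; rewrite mv_mmul, IH by auto.
  now rewrite (mv_ext d (D n) _ (seqv d D x n)).
Qed.

Definition gram (d : nat) (W : Mat) : Mat :=
  fun i j => csum d (fun k => Cmul (Cconj (W k i)) (W k j)).

Lemma hermitian_gram d W : hermitian d (gram d W).
Proof.
  intros i j _ _; unfold gram; rewrite <- csum_conj; apply csum_ext; intros k _.
  rewrite Cconj_mul, Cconj_conj; ring.
Qed.

Lemma gram_idm d i j : (i < d)%nat -> (j < d)%nat -> gram d idm i j = idm i j.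
Proof.
  intros Hi Hj; unfold gram; rewrite (csum_delta d i); auto.
  - unfold idm at 1; rewrite Nat.eqb_refl.
    transitivity (Cmul C1 (idm i j)); [|ring]; f_equal; apply C_eq; simpl; ring.
  - intros k _ Hk; unfold idm at 1; destruct (Nat.eqb_spec k i); [congruence|].
    transitivity (Cmul C0 (idm k j)); [|ring]; f_equal; apply C_eq; simpl; ring.
Qed.

Lemma form_gram d W x : form d (gram d W) x = ip d (mv d W x) (mv d W x).
Proof.
  unfold form, ip; f_equal; unfold cdot, mv, gram.
  transitivity (csum d (fun i => csum d (fun k =>
     Cmul (Cmul (Cconj (x i)) (Cconj (W k i))) (mv d W x k)))).
  - apply csum_ext; intros i _.
    rewrite <- csum_mul_l.
    rewrite (csum_ext d _ (fun j => csum d (fun k =>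
      Cmul (Cmul (Cconj (x i)) (Cconj (W k i))) (Cmul (W k j) (x j))))).
    2:{ intros j _; rewrite <- csum_mul_r, <- csum_mul_l; apply csum_ext; intros; ring. }
    rewrite csum_swap; apply csum_ext; intros k _; now rewrite csum_mul_l.
  - rewrite csum_swap; apply csum_ext; intros k _; rewrite csum_mul_r.
    f_equal; rewrite <- csum_conj; apply csum_ext; intros i _.
    rewrite Cconj_mul; ring.
Qed.

(** With [W] the ordered product of the [I - D i] for [i < n], this is [W^* W]: the effect of the
    event that the first [n] tests all fail. *)
Definition survive (d : nat) (D : nat -> Mat) (n : nat) : Mat := gram d (seqm d D n).

Lemma form_survive d D n x :
  form d (survive d D n) x = ip d (seqv d D x n) (seqv d D x n).
Proof.
  unfold survive; rewrite form_gram; apply ip_ext; intros; now apply mv_seqm.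
Qed.

(* Messages own blocks of [K] consecutive tests, performed in order; the last message
   also absorbs the event that every test fails. *)
Definition decoder (d K M : nat) (Gam : nat -> Mat) (m : nat) : Mat :=
  if Nat.eqb (S m) M then survive d Gam (m * K)
  else msub (survive d Gam (m * K)) (survive d Gam (S m * K)).

Lemma decoder_povm d K M Gam :
  (1 <= M)%nat -> (forall i, effect d (Gam i)) -> povm d M (decoder d K M Gam).
Proof.
  intros HM HG; split.
  - intros m _; unfold decoder; split.
    + destruct (Nat.eqb (S m) M); [apply hermitian_gram|].
      apply hermitian_msub; apply hermitian_gram.
    + intros x; change (0 <= form d (decoder d K M Gam m) x); unfold decoder.
      destruct (Nat.eqb (S m) M).
      * rewrite form_survive; apply ip_self_nonneg.
      * rewrite form_msub, !form_survive.
        assert (H := seqv_norm_decr d Gam x (m * K) K HG).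
        replace (S m * K)%nat with (m * K + K)%nat by lia; lra.
  - intros i j Hi Hj.
    (* The effects telescope; the last message then takes exactly the remainder. *)
    assert (Hpart : forall n, (n < M)%nat ->
      msum n (decoder d K M Gam) i j = Cadd (idm i j) (Copp (survive d Gam (n * K) i j))).
    { induction n as [|n IH]; intros Hn; unfold msum in *; simpl.
      - unfold survive; simpl; rewrite gram_idm by auto; ring.
      - rewrite IH by lia; unfold decoder.
        destruct (Nat.eqb_spec (S n) M); [lia|]; unfold msub; simpl; ring. }
    destruct M as [|n]; [lia|].
    unfold msum in *; simpl; rewrite Hpart by lia; unfold decoder; rewrite Nat.eqb_refl; ring.
Qed.

(** The bad events when codeword [j] was sent: an earlier test accepts, or test [j] rejects.
    Escaping all of them means that the first success occurs at [j]. *)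
Definition tests (Gam : nat -> Mat) (j i : nat) : Mat :=
  if Nat.eqb i j then msub idm (Gam j) else Gam i.

(** On an input [x], let [z] be the vector that reaches test [j]. The union bound for [tests]
    controls [|x|^2 - |Gam j z|^2], while the effect of message [m] collects at least the norm lost
    over its block, hence at least the loss at test [j]. *)
Lemma decoder_error d K M Gam m k :
  (forall i, effect d (Gam i)) -> (k < K)%nat ->
  let j := (m * K + k)%nat in
  psd d (msub (mscale 4 (msum (S j) (tests Gam j))) (msub idm (decoder d K M Gam m))).
Proof.
  intros HG Hk j.
  assert (HD : forall i, effect d (tests Gam j i)).
  { intros i; unfold tests; destruct (Nat.eqb i j); auto; now apply effect_complement. }
  split.
  - repeat apply hermitian_msub.
    + apply hermitian_mscale, hermitian_msum; intros i _; apply (HD i).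
    + apply hermitian_idm.
    + unfold decoder; destruct (Nat.eqb (S m) M); [|apply hermitian_msub]; apply hermitian_gram.
  - intros x.
    change (0 <= form d (msub (mscale 4 (msum (S j) (tests Gam j)))
                          (msub idm (decoder d K M Gam m))) x).
    rewrite !form_msub, form_mscale, form_msum, form_idm.
    assert (Hub := seqv_union_bound d (tests Gam j) x (S j) HD).
    assert (Hpre : forall n i, (n <= j)%nat -> (i < d)%nat ->
                   seqv d (tests Gam j) x n i = seqv d Gam x n i).
    { induction n as [|n IH]; intros i Hn Hi; [reflexivity|]; simpl; unfold vsub.
      rewrite IH by (auto; lia); f_equal; f_equal.
      unfold tests at 1; destruct (Nat.eqb_spec n j); [lia|].
      apply mv_ext; intros; apply IH; auto; lia. }
    set (z := seqv d Gam x j) in *.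
    assert (Hlast : ip d (seqv d (tests Gam j) x (S j)) (seqv d (tests Gam j) x (S j))
                    = ip d (mv d (Gam j) z) (mv d (Gam j) z)).
    { assert (E : forall i, (i < d)%nat ->
         seqv d (tests Gam j) x (S j) i = mv d (Gam j) z i).
      { intros i Hi; simpl; unfold vsub at 1.
        unfold tests at 2; rewrite Nat.eqb_refl.
        rewrite mv_complement by auto; unfold vsub; rewrite Hpre by auto; fold z.
        rewrite (mv_ext d (Gam j) _ z) by (intros; now apply Hpre); ring. }
      now apply ip_ext. }
    rewrite Hlast in Hub.
    (* The loss at test [j] is [2 <z, Gam z> - |Gam z|^2], which by this inequality is at least
       [|Gam z|^2]. *)
    assert (Hsq := effect_square_le d _ z (HG j)).
    assert (Hstep := seqv_step_norm d Gam x j); fold z in Hstep.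
    assert (Hbefore := seqv_norm_decr d Gam x (m * K) k HG).
    fold j in Hbefore; fold z in Hbefore.
    assert (Hdec : ip d z z - ip d (seqv d Gam x (S j)) (seqv d Gam x (S j))
                   <= form d (decoder d K M Gam m) x).
    { unfold decoder; destruct (Nat.eqb (S m) M).
      - rewrite form_survive.
        assert (H := ip_self_nonneg d (seqv d Gam x (S j))); lra.
      - rewrite form_msub, !form_survive.
        assert (H := seqv_norm_decr d Gam x (S j) (K - S k) HG).
        replace (S j + (K - S k))%nat with (S m * K)%nat in H by (unfold j; nia).
        lra. }
    lra.
Qed.

(** * Traces and tensor products *)

Lemma psd_ext d A B :
  (forall i j, (i < d)%nat -> (j < d)%nat -> A i j = B i j) -> psd d A -> psd d B.
Proof.
  intros E [H1 H2]; split.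
  - intros i j Hi Hj; rewrite <- !E by auto; auto.
  - intros v; replace (csum d _) with
      (csum d (fun i => Cmul (Cconj (v i)) (csum d (fun j => Cmul (A i j) (v j))))); auto.
    apply csum_ext; intros i Hi; f_equal; apply csum_ext; intros j Hj; now rewrite E.
Qed.

(** * Cholesky decomposition *)

Definition Cnorm2 (b : Defs.C) : R := re b * re b + im b * im b.

(** The right side is the quadratic form of [A] at [v] extended by the last coordinate [z]. *)
Lemma psd_last_row n A v z :
  psd (S n) A ->
  0 <= form n A v + 2 * re (Cmul (Cconj z) (mv n A v n)) + re (A n n) * Cnorm2 z.
Proof.
  intros HA; assert (Hh := proj1 HA).
  set (x := fun i => if Nat.eqb i n then z else v i).
  assert (H := psd_form _ _ x HA).
  assert (Ex : forall i, (i < n)%nat -> x i = v i).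
  { intros i Hi; unfold x; destruct (Nat.eqb_spec i n); [lia|auto]. }
  assert (En : x n = z) by (unfold x; now rewrite Nat.eqb_refl).
  assert (Hmv : forall i, mv (S n) A x i = Cadd (mv n A v i) (Cmul (A i n) z)).
  { intros i; unfold mv; simpl; rewrite En; f_equal; apply csum_ext; intros j Hj.
    now rewrite Ex. }
  assert (Hcol : csum n (fun i => Cmul (Cconj (v i)) (A i n)) = Cconj (mv n A v n)).
  { unfold mv; rewrite <- csum_conj; apply csum_ext; intros i Hi.
    rewrite (Hh i n), Cconj_mul by lia; ring. }
  assert (Hq : cdot (S n) x (mv (S n) A x) =
    Cadd (cdot n v (mv n A v)) (Cadd (Cmul (Cconj (mv n A v n)) z)
      (Cmul (Cconj z) (Cadd (mv n A v n) (Cmul (A n n) z))))).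
  { unfold cdot; simpl; rewrite En, Hmv, <- Hcol.
    rewrite (csum_ext n _ (fun i => Cadd (Cmul (Cconj (v i)) (mv n A v i))
               (Cmul (Cmul (Cconj (v i)) (A i n)) z))).
    2:{ intros i Hi; rewrite Ex, Hmv by auto; ring. }
    rewrite csum_add, csum_mul_r; ring. }
  assert (Him : im (A n n) = 0).
  { assert (E := f_equal im (Hh n n ltac:(lia) ltac:(lia))); simpl in E; lra. }
  unfold form, ip in *; rewrite Hq in H; simpl in *; rewrite Him in H.
  unfold Cnorm2; lra.
Qed.

(* One step of Cholesky elimination: with [s = 1 / A n n], or [s = 0] when the last
   row vanishes, subtracting [s] times the last column times the last row leaves a
   positive semidefinite matrix. *)
Lemma psd_eliminate n A :
  psd (S n) A ->
  exists s, 0 <= s /\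
    psd n (fun i j => Cadd (A i j) (Copp (Cscale s (Cmul (A i n) (A n j))))) /\
    (forall j, (j <= n)%nat -> A n j = Cscale s (Cmul (A n n) (A n j))).
Proof.
  intros HA; assert (Hh := proj1 HA).
  assert (Ha : 0 <= re (A n n)).
  { assert (H := psd_last_row n A (fun _ => C0) (mkC 1 0) HA).
    assert (E0 : forall i, mv n A (fun _ => C0) i = C0).
    { intros i; unfold mv; rewrite (csum_ext n _ (fun _ => C0)), csum_0; intros; ring. }
    assert (Ef : form n A (fun _ => C0) = 0).
    { unfold form, ip, cdot; rewrite (csum_ext n _ (fun _ => C0)), csum_0; [reflexivity|].
      intros; rewrite E0; ring. }
    rewrite Ef, E0 in H; unfold Cnorm2 in H; simpl in H; lra. }
  assert (Him : A n n = mkC (re (A n n)) 0).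
  { assert (E := f_equal im (Hh n n ltac:(lia) ltac:(lia))).
    apply C_eq; simpl in *; [auto|lra]. }
  set (a := re (A n n)) in *.
  assert (Hs : exists s, 0 <= s /\ a * s * s = s /\
                 forall j, (j <= n)%nat -> A n j = Cscale (s * a) (A n j)).
  { destruct Ha as [Ha|Ha].
    - exists (/ a); split; [now apply Rlt_le, Rinv_0_lt_compat|]; split; [field; lra|].
      intros j _; rewrite Rinv_l by lra; apply C_eq; simpl; ring.
    - exists 0; split; [lra|]; split; [ring|].
      intros j Hj.
      assert (E : A n j = C0); [|rewrite E; apply C_eq; simpl; ring].
      destruct (Nat.eq_dec j n) as [->|Hne]; [now rewrite Him, <- Ha|].
      set (v := fun i => if Nat.eqb i j then C1 else C0).
      assert (Eb : mv n A v n = A n j).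
      { unfold mv; rewrite (csum_delta n j) by
          (lia || (intros i _ Hi; unfold v; destruct (Nat.eqb_spec i j); [lia|ring])).
        unfold v; rewrite Nat.eqb_refl; ring. }
      destruct (Rle_lt_or_eq_dec 0 (Cnorm2 (A n j))) as [Hb|Hb].
      { unfold Cnorm2; apply Rplus_le_le_0_compat; apply Rle_0_sqr. }
      + exfalso.
        (* With a zero diagonal entry the form is affine in [l]; this [l] gives it the value -1, a
           contradiction. *)
        set (l := (form n A v + 1) / (2 * Cnorm2 (A n j))).
        assert (H := psd_last_row n A v (Cscale (- l) (A n j)) HA).
        fold a in H; rewrite Eb, <- Ha, Rmult_0_l, Rplus_0_r in H.
        replace (re (Cmul (Cconj (Cscale (- l) (A n j))) (A n j)))
          with (- l * Cnorm2 (A n j)) in H by (unfold Cnorm2; simpl; ring).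
        replace (2 * (- l * Cnorm2 (A n j))) with (- (form n A v + 1)) in H
          by (unfold l; field; lra).
        lra.
      + assert (H1 := Rle_0_sqr (re (A n j))); assert (H2 := Rle_0_sqr (im (A n j))).
        unfold Cnorm2, Rsqr in *; apply C_eq; apply Rsqr_0_uniq; unfold Rsqr; simpl; lra. }
  destruct Hs as [s [Hs [Hss Hrow]]]; exists s; split; [auto|]; split; [split|].
  - intros i j Hi Hj; rewrite !Cscale_mul, Cconj_add, Cconj_opp, !Cconj_mul.
    rewrite <- (Hh i j), <- (Hh n j), <- (Hh i n) by lia.
    replace (Cconj (mkC s 0)) with (mkC s 0) by (apply C_eq; simpl; ring). ring.
  - intros v.
    set (b := mv n A v n).
    (* For [s = 1 / A n n] the last coordinate [- s b] completes the square, and what remains is the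
       form of the Schur complement. *)
    assert (H := psd_last_row n A v (Cscale (- s) b) HA); fold b a in H.
    replace (re (Cmul (Cconj (Cscale (- s) b)) b)) with (- s * Cnorm2 b) in H
      by (unfold Cnorm2; simpl; ring).
    replace (a * Cnorm2 (Cscale (- s) b)) with (a * s * s * Cnorm2 b) in H
      by (unfold Cnorm2; simpl; ring).
    rewrite Hss in H.
    assert (Hcol : csum n (fun i => Cmul (Cconj (v i)) (A i n)) = Cconj b).
    { unfold b, mv; rewrite <- csum_conj; apply csum_ext; intros i Hi.
      rewrite (Hh i n), Cconj_mul by lia; ring. }
    replace (csum n _) with (Cadd (cdot n v (mv n A v)) (Copp (Cscale s (Cmul (Cconj b) b)))).
    { unfold form, ip in H; unfold Cnorm2 in H; simpl in *; lra. }
    rewrite <- Hcol, Cscale_mul, <- csum_mul_r, <- csum_mul_l, <- csum_opp.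
    unfold cdot; rewrite <- csum_add; apply csum_ext; intros i _.
    unfold b, mv.
    transitivity (Cmul (Cconj (v i)) (Cadd (csum n (fun j => Cmul (A i j) (v j)))
       (Cmul (Copp (Cmul (mkC s 0) (A i n))) (csum n (fun j => Cmul (A n j) (v j)))))); [ring|].
    f_equal; rewrite <- csum_mul_l, <- csum_add; apply csum_ext; intros j _.
    rewrite Cscale_mul; ring.
  - intros j Hj; rewrite (Hrow j Hj) at 1; rewrite Him, !Cscale_mul.
    transitivity (Cmul (Cmul (mkC s 0) (mkC a 0)) (A n j)); [|ring].
    f_equal; apply C_eq; simpl; ring.
Qed.

Definition outer (y : nat -> Defs.C) : Mat := fun i j => Cmul (y i) (Cconj (y j)).

(** Iterated elimination yields rank-one terms. They play the part of a spectral decomposition in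
    the positivity of Kronecker products. *)
Lemma psd_sum_outer d A :
  psd d A ->
  exists (s : nat -> R) (V : nat -> nat -> Defs.C), (forall k, 0 <= s k) /\
    forall i j, (i < d)%nat -> (j < d)%nat ->
      A i j = msum d (fun k => mscale (s k) (outer (V k))) i j.
Proof.
  revert A; induction d as [|n IH]; intros A HA.
  - exists (fun _ => 0), (fun _ _ => C0); split; [intros; lra|]; intros; lia.
  - assert (Hh := proj1 HA).
    destruct (psd_eliminate n A HA) as [s0 [Hs0 [HA' Hrow]]].
    destruct (IH _ HA') as [s [V [Hs HV]]].
    (* The new vector is the last column of [A]. The others are padded with 0 at coordinate [n],
       where by [Hrow] the new term alone reproduces [A]. *)
    exists (fun k => if Nat.eqb k n then s0 else s k),
      (fun k i => if Nat.eqb k n then A i n else if Nat.eqb i n then C0 else V k i).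
    split; [intros k; destruct (Nat.eqb k n); auto|].
    intros i j Hi Hj; unfold msum, mscale, outer; simpl.
    rewrite Nat.eqb_refl, <- (Hh n j) by lia.
    rewrite (csum_ext n _ (fun k => Cscale (s k) (Cmul (if Nat.eqb i n then C0 else V k i)
               (Cconj (if Nat.eqb j n then C0 else V k j)))))
      by (intros k Hk; destruct (Nat.eqb_spec k n); [lia|reflexivity]).
    assert (Hzero : forall g, (forall k, g k = C0) -> csum n g = C0).
    { intros g Hg; rewrite (csum_ext n g (fun _ => C0)), csum_0; auto. }
    destruct (Nat.eqb_spec i n) as [->|Hin].
    { rewrite Hzero by (intros k; apply C_eq; simpl; ring).
      rewrite <- Hrow by lia; ring. }
    destruct (Nat.eqb_spec j n) as [->|Hjn].
    { rewrite Hzero by (intros k; apply C_eq; simpl; ring).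
      assert (E := f_equal Cconj (Hrow i ltac:(lia))).
      rewrite Cscale_mul, !Cconj_mul, <- (Hh i n), <- (Hh n n) in E by lia.
      rewrite E at 1; rewrite Cscale_mul.
      replace (Cconj (mkC s0 0)) with (mkC s0 0) by (apply C_eq; simpl; ring). ring. }
    change (csum n _) with (msum n (fun k => mscale (s k) (outer (V k))) i j).
    rewrite <- HV by lia; ring.
Qed.

Definition trm (d : nat) (A B : Mat) : R := re (mtrace d (mmul d A B)).

Lemma trm_ext d A A' B B' :
  (forall i j, (i < d)%nat -> (j < d)%nat -> A i j = A' i j) ->
  (forall i j, (i < d)%nat -> (j < d)%nat -> B i j = B' i j) ->
  trm d A B = trm d A' B'.
Proof.
  intros HA HB; unfold trm, mtrace, mmul; f_equal.
  apply csum_ext; intros i Hi; apply csum_ext; intros j Hj; now rewrite HA, HB.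
Qed.

Lemma trm_comm d A B : trm d A B = trm d B A.
Proof.
  unfold trm, mtrace, mmul; f_equal; rewrite csum_swap.
  apply csum_ext; intros i _; apply csum_ext; intros j _; ring.
Qed.

Lemma trm_msub_l d A A' B : trm d (msub A A') B = trm d A B - trm d A' B.
Proof.
  unfold trm, mtrace, mmul; unfold Rminus.
  change (re ?x + - re ?y) with (re (Cadd x (Copp y))); f_equal.
  rewrite <- csum_opp, <- csum_add; apply csum_ext; intros i _.
  rewrite <- csum_opp, <- csum_add; apply csum_ext; intros j _; unfold msub; ring.
Qed.

Lemma trm_mscale_r d A r B : trm d A (mscale r B) = r * trm d A B.
Proof.
  unfold trm, mtrace, mmul; rewrite !csum_re, <- rsum_scal; apply rsum_ext; intros i _.
  rewrite !csum_re, <- rsum_scal; apply rsum_ext; intros j _; simpl; ring.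
Qed.

Lemma trm_mscale_l d r A B : trm d (mscale r A) B = r * trm d A B.
Proof. rewrite !(trm_comm d _ B); apply trm_mscale_r. Qed.

Lemma trm_msum_r d A n F : trm d A (msum n F) = rsum n (fun k => trm d A (F k)).
Proof.
  unfold trm, mtrace, mmul; rewrite <- csum_re; f_equal; symmetry.
  rewrite csum_swap; apply csum_ext; intros i _.
  rewrite csum_swap; apply csum_ext; intros j _; unfold msum; now rewrite csum_mul_l.
Qed.

Lemma trm_msum_l d n F B : trm d (msum n F) B = rsum n (fun k => trm d (F k) B).
Proof.
  rewrite trm_comm, trm_msum_r; apply rsum_ext; intros; apply trm_comm.
Qed.

Lemma trm_outer d y B : trm d (outer y) B = form d B y.
Proof.
  rewrite trm_comm; unfold trm, form, ip, mtrace, mmul, cdot, mv, outer; f_equal.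
  apply csum_ext; intros i _; rewrite <- csum_mul_l; apply csum_ext; intros; ring.
Qed.

Lemma trm_idm d B : trm d idm B = re (mtrace d B).
Proof.
  unfold trm, mtrace, mmul; f_equal; apply csum_ext; intros i Hi.
  rewrite (csum_delta d i); unfold idm; auto.
  - rewrite Nat.eqb_refl; ring.
  - intros j _ Hj; destruct (Nat.eqb_spec i j); [congruence|ring].
Qed.

(** * Kronecker products, partial traces and diagonal blocks *)

Lemma index_div a b d : (b < d)%nat -> ((a * d + b) / d = a)%nat.
Proof. intros Hb; rewrite Nat.div_add_l, Nat.div_small by lia; lia. Qed.

Lemma index_mod a b d : (b < d)%nat -> ((a * d + b) mod d = b)%nat.
Proof. intros Hb; rewrite Nat.add_comm, Nat.Div0.mod_add, Nat.mod_small by lia; lia. Qed.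

Lemma split_index i n d :
  (i < n * d)%nat -> exists a b, (a < n)%nat /\ (b < d)%nat /\ i = (a * d + b)%nat.
Proof.
  intros Hi; exists (i / d)%nat, (i mod d)%nat.
  assert (d <> 0)%nat by lia.
  split; [apply Nat.Div0.div_lt_upper_bound; lia|].
  split; [now apply Nat.mod_upper_bound|].
  rewrite (Nat.div_mod_eq i d) at 1; lia.
Qed.

Lemma kron_idm dB dC i j :
  (i < dB * dC)%nat -> (j < dB * dC)%nat -> kron dC idm idm i j = idm i j.
Proof.
  intros Hi Hj.
  destruct (split_index i _ _ Hi) as [a [b [Ha [Hb ->]]]].
  destruct (split_index j _ _ Hj) as [a' [b' [Ha' [Hb' ->]]]].
  unfold kron; rewrite !index_div, !index_mod by auto; unfold idm.
  destruct (Nat.eqb_spec a a') as [<-|Hne].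
  - destruct (Nat.eqb_spec b b') as [<-|Hne]; [rewrite Nat.eqb_refl; ring|].
    destruct (Nat.eqb_spec (a * dC + b) (a * dC + b')); [lia|ring].
  - destruct (Nat.eqb_spec (a * dC + b) (a' * dC + b')) as [E|E]; [|ring].
    exfalso; apply Hne; rewrite <- (index_div a b dC), E by auto; now apply index_div.
Qed.

(** Both factors split into rank-one terms. The product of two such terms is the outer square of a
    product vector, whose trace against [rho] is a value of the form of [rho]. *)
Lemma trm_kron_psd dB dC A B rho :
  psd dB A -> psd dC B -> psd (dB * dC) rho -> 0 <= trm (dB * dC) (kron dC A B) rho.
Proof.
  intros HA HB Hrho.
  destruct (psd_sum_outer dB A HA) as [s [V [Hs HV]]].
  destruct (psd_sum_outer dC B HB) as [t [W [Ht HW]]].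
  rewrite (trm_ext _ _ (msum dB (fun k => msum dC (fun l =>
      mscale (s k * t l) (outer (fun i => Cmul (V k (i / dC)%nat) (W l (i mod dC)%nat))))))
      _ rho); auto.
  - rewrite trm_msum_l; apply rsum_nonneg; intros k _.
    rewrite trm_msum_l; apply rsum_nonneg; intros l _.
    rewrite trm_mscale_l, trm_outer; apply Rmult_le_pos; [now apply Rmult_le_pos|].
    now apply psd_form.
  - intros i j Hi Hj.
    destruct (split_index i _ _ Hi) as [a [b [Ha [Hb ->]]]].
    destruct (split_index j _ _ Hj) as [a' [b' [Ha' [Hb' ->]]]].
    unfold kron, msum, mscale, outer; rewrite !index_div, !index_mod, HV, HW by auto.
    unfold msum; rewrite <- csum_mul_r; apply csum_ext; intros k _.
    rewrite <- csum_mul_l; apply csum_ext; intros l _.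
    unfold mscale, outer; rewrite !Cscale_mul, !Cconj_mul.
    replace (mkC (s k * t l) 0) with (Cmul (mkC (s k) 0) (mkC (t l) 0))
      by (apply C_eq; simpl; ring).
    ring.
Qed.

Lemma trm_kron_idm_r dB dC A rho :
  trm (dB * dC) (kron dC A idm) rho = trm dB A (ptrC dC rho).
Proof.
  unfold trm, mtrace, mmul, ptrC; f_equal; rewrite csum_mul_index.
  apply csum_ext; intros a _.
  transitivity (csum dC (fun b => csum dB (fun a' =>
    Cmul (A a a') (rho (a' * dC + b)%nat (a * dC + b)%nat)))).
  - apply csum_ext; intros b Hb; rewrite csum_mul_index; apply csum_ext; intros a' _.
    rewrite (csum_delta dC b) by (lia || (intros b' Hb' Hne; unfold kron, idm;
      rewrite !index_mod by auto; destruct (Nat.eqb_spec b b'); [congruence|ring])).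
    unfold kron, idm; rewrite !index_div, !index_mod, Nat.eqb_refl by auto; ring.
  - rewrite csum_swap; apply csum_ext; intros a' _; now rewrite csum_mul_l.
Qed.

Lemma trm_kron_idm_l dB dC B rho :
  trm (dB * dC) (kron dC idm B) rho = trm dC B (ptrB dB dC rho).
Proof.
  unfold trm, mtrace, mmul, ptrB; f_equal; rewrite csum_mul_index, csum_swap.
  apply csum_ext; intros b Hb.
  transitivity (csum dB (fun a => csum dC (fun b' =>
    Cmul (B b b') (rho (a * dC + b')%nat (a * dC + b)%nat)))).
  - apply csum_ext; intros a Ha; rewrite csum_mul_index.
    rewrite (csum_delta dB a); auto.
    + apply csum_ext; intros b' Hb'; unfold kron, idm.
      rewrite !index_div, !index_mod, Nat.eqb_refl by auto; ring.
    + intros a' _ Hne; rewrite (csum_ext dC _ (fun _ => C0)), csum_0; auto.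
      intros b' Hb'; unfold kron, idm; rewrite !index_div by auto.
      destruct (Nat.eqb_spec a a'); [congruence|ring].
  - rewrite csum_swap; apply csum_ext; intros b' _; now rewrite csum_mul_l.
Qed.

(** The compression of [Gam] to the classical value [u]. Against a state that is diagonal in the
    first register only these blocks count, and block [u] serves as the test for the letter [u]. *)
Definition block (d u : nat) (Gam : Mat) : Mat :=
  fun i j => Gam (u * d + i)%nat (u * d + j)%nat.

Lemma trm_kron_proj n d u Gam S :
  (u < n)%nat -> trm (n * d) Gam (kron d (proj u) S) = trm d (block d u Gam) S.
Proof.
  intros Hu; unfold trm, mtrace, mmul, block; f_equal; rewrite csum_mul_index.
  rewrite (csum_delta n u); auto.
  - apply csum_ext; intros b Hb; rewrite csum_mul_index, (csum_delta n u); auto.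
    + apply csum_ext; intros b' Hb'; unfold kron, proj.
      rewrite !index_div, !index_mod, !Nat.eqb_refl by auto; simpl; ring.
    + intros a' _ Hne; rewrite (csum_ext d _ (fun _ => C0)), csum_0; auto.
      intros b' Hb'; unfold kron, proj; rewrite !index_div by auto.
      destruct (Nat.eqb_spec a' u); [congruence|simpl; ring].
  - intros a _ Hne; rewrite (csum_ext d _ (fun _ => C0)), csum_0; auto.
    intros b Hb; rewrite csum_mul_index, (csum_ext n _ (fun _ => C0)), csum_0; auto.
    intros a' _; rewrite (csum_ext d _ (fun _ => C0)), csum_0; auto.
    intros b' Hb'; unfold kron, proj; rewrite !index_div by auto.
    destruct (Nat.eqb_spec a u); [congruence|]; rewrite Bool.andb_false_r; ring.
Qed.

Lemma psd_block n d u Gam : (u < n)%nat -> psd (n * d) Gam -> psd d (block d u Gam).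
Proof.
  intros Hu [Hh Hq]; split.
  - intros i j Hi Hj; apply Hh; nia.
  - intros v.
    specialize (Hq (fun i => if Nat.eqb (i / d) u then v (i mod d)%nat else C0)).
    replace (csum d _) with (csum (n * d) (fun i =>
      Cmul (Cconj (if Nat.eqb (i / d) u then v (i mod d)%nat else C0))
        (csum (n * d) (fun j => Cmul (Gam i j)
           (if Nat.eqb (j / d) u then v (j mod d)%nat else C0))))); [exact Hq|].
    assert (Hinner : forall i, csum (n * d) (fun j => Cmul (Gam i j)
           (if Nat.eqb (j / d) u then v (j mod d)%nat else C0))
         = csum d (fun j => Cmul (Gam i (u * d + j)%nat) (v j))).
    { intros i; rewrite csum_mul_index, (csum_delta n u); auto.
      - apply csum_ext; intros j Hj; now rewrite index_div, index_mod, Nat.eqb_refl.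
      - intros a _ Hne; rewrite (csum_ext d _ (fun _ => C0)), csum_0; auto.
        intros b Hb; rewrite index_div by auto.
        destruct (Nat.eqb_spec a u); [congruence|ring]. }
    rewrite csum_mul_index, (csum_delta n u); auto.
    + apply csum_ext; intros i Hi; rewrite Hinner, index_div, index_mod, Nat.eqb_refl by auto.
      reflexivity.
    + intros a _ Hne; rewrite (csum_ext d _ (fun _ => C0)), csum_0; auto.
      intros b Hb; rewrite index_div by auto.
      destruct (Nat.eqb_spec a u); [congruence|]; apply C_eq; simpl; ring.
Qed.

Lemma effect_block n d u Gam : (u < n)%nat -> effect (n * d) Gam -> effect d (block d u Gam).
Proof.
  intros Hu [H1 H2]; split; [now apply (psd_block n)|].
  apply psd_ext with (2 := psd_block n d u _ Hu H2); intros i j Hi Hj.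
  unfold block, msub, idm; f_equal.
  destruct (Nat.eqb_spec i j), (Nat.eqb_spec (u * d + i) (u * d + j)); auto; lia.
Qed.

Lemma trm_cq_state n d Gam nu nv p (g : nat -> nat -> nat) (S : nat -> nat -> Mat) :
  (forall u v, (u < nu)%nat -> (v < nv)%nat -> (g u v < n)%nat) ->
  trm (n * d) Gam (msum nu (fun u => msum nv (fun v =>
    mscale (p u v) (kron d (proj (g u v)) (S u v)))))
  = rsum nu (fun u => rsum nv (fun v => p u v * trm d (block d (g u v) Gam) (S u v))).
Proof.
  intros Hg; rewrite trm_msum_r; apply rsum_ext; intros u Hu.
  rewrite trm_msum_r; apply rsum_ext; intros v Hv.
  rewrite trm_mscale_r, trm_kron_proj; auto.
Qed.

Lemma trm_product_state n d Gam nu nv q p (S : nat -> nat -> Mat) :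
  trm (n * d) Gam (kron d (msum n (fun w => mscale (q w) (proj w)))
    (msum nu (fun u => msum nv (fun v => mscale (p u v) (S u v)))))
  = rsum n (fun w => q w * rsum nu (fun u => rsum nv (fun v =>
      p u v * trm d (block d w Gam) (S u v)))).
Proof.
  set (X := msum nu _).
  rewrite (trm_ext _ _ Gam _ (msum n (fun w => mscale (q w) (kron d (proj w) X)))); auto.
  - rewrite trm_msum_r; apply rsum_ext; intros w Hw.
    rewrite trm_mscale_r, trm_kron_proj by auto; f_equal; unfold X.
    rewrite trm_msum_r; apply rsum_ext; intros u _.
    rewrite trm_msum_r; apply rsum_ext; intros v _; apply trm_mscale_r.
  - intros i j _ _; unfold kron, msum, mscale; rewrite <- csum_mul_r.
    apply csum_ext; intros w _; rewrite !Cscale_mul; ring.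
Qed.

(** [S] will be a partial trace. It enters only as a functional that is nonnegative on positive
    semidefinite matrices, which is the form in which positivity of a marginal is available. *)
Lemma decoder_error_trm d K M Gam m k S :
  (forall i, effect d (Gam i)) -> (k < K)%nat -> (forall A, psd d A -> 0 <= trm d A S) ->
  let j := (m * K + k)%nat in
  trm d (msub idm (decoder d K M Gam m)) S
  <= 4 * (trm d (msub idm (Gam j)) S + rsum j (fun i => trm d (Gam i) S)).
Proof.
  intros HG Hk Hpos j.
  assert (H := Hpos _ (decoder_error d K M Gam m k HG Hk)); cbv zeta in H; fold j in H.
  rewrite trm_msub_l, trm_mscale_l, trm_msum_l in H; simpl in H.
  rewrite (rsum_ext j _ (fun i => trm d (Gam i) S)) in H
    by (intros i Hi; unfold tests; destruct (Nat.eqb_spec i j); [lia|reflexivity]).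
  unfold tests in H; rewrite Nat.eqb_refl in H; lra.
Qed.

(* [I - A (x) B = (I - A) (x) I + I (x) (I - B) - (I - A) (x) (I - B)]. *)
Lemma trm_kron_union dB dC A B rho :
  effect dB A -> effect dC B -> psd (dB * dC) rho ->
  trm (dB * dC) (msub idm (kron dC A B)) rho
  <= trm dB (msub idm A) (ptrC dC rho) + trm dC (msub idm B) (ptrB dB dC rho).
Proof.
  intros HA HB Hrho.
  assert (H := trm_kron_psd dB dC _ _ rho (proj2 HA) (proj2 HB) Hrho).
  rewrite <- trm_kron_idm_r, <- trm_kron_idm_l.
  rewrite (trm_ext _ _ (msub (kron dC (msub idm A) idm)
             (msub (kron dC (msub idm A) (msub idm B)) (kron dC idm (msub idm B)))) _ rho); auto.
  - rewrite !trm_msub_l; lra.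
  - intros i j Hi Hj; unfold msub at 1; rewrite <- (kron_idm dB dC i j) by auto.
    unfold msub, kron; ring.
Qed.

(** * Rates *)

Lemma ln2_pos : 0 < ln 2.
Proof. rewrite <- ln_1; apply ln_increasing; lra. Qed.

Lemma log2_mult x y : 0 < x -> 0 < y -> log2 (x * y) = log2 x + log2 y.
Proof. intros Hx Hy; unfold log2; rewrite ln_mult by auto; unfold Rdiv; ring. Qed.

Lemma log2_pow x n : 0 < x -> log2 (x ^ n) = INR n * log2 x.
Proof. intros Hx; unfold log2; rewrite ln_pow by auto; unfold Rdiv; ring. Qed.

Lemma log2_2 : log2 2 = 1.
Proof. unfold log2; field; assert (H := ln2_pos); lra. Qed.

Lemma Rpower_log2 x : 0 < x -> Rpower 2 (log2 x) = x.
Proof.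
  intros Hx; unfold Rpower, log2, Rdiv.
  rewrite Rmult_assoc, Rinv_l, Rmult_1_r by (assert (H := ln2_pos); lra); now apply exp_ln.
Qed.

Lemma log2_Rpower a : log2 (Rpower 2 a) = a.
Proof. unfold log2; rewrite ln_Rpower; field; assert (H := ln2_pos); lra. Qed.

Lemma log2_le x y : 0 < x -> x <= y -> log2 x <= log2 y.
Proof.
  intros Hx Hxy; unfold log2; apply Rmult_le_compat_r.
  - apply Rlt_le, Rinv_0_lt_compat, ln2_pos.
  - destruct Hxy as [Hxy| ->]; [apply Rlt_le; now apply ln_increasing|apply Rle_refl].
Qed.

Lemma log2_le_Rpower x a : 0 < x -> log2 x <= a -> x <= Rpower 2 a.
Proof.
  intros Hx H; rewrite <- (Rpower_log2 x Hx).
  destruct H as [H| ->]; [apply Rlt_le, Rpower_lt; lra|lra].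
Qed.

Lemma Rpower2_pos a : 0 < Rpower 2 a.
Proof. apply exp_pos. Qed.

(** The strict inequality is what contradicts the supremum or the infimum in the witness lemmas. *)
Lemma log2_slack a : log2 (9 / 8 * Rpower 2 a) > a.
Proof.
  rewrite log2_mult, log2_Rpower by (lra || apply Rpower2_pos).
  assert (0 < log2 (9 / 8)); [|lra].
  apply Rdiv_lt_0_compat; [rewrite <- ln_1; apply ln_increasing; lra|apply ln2_pos].
Qed.

(* The factor [9/8] pays for the supremum possibly not being attained. *)
Lemma I0_witness D J sigma eps0 I0 a :
  is_I0 D J sigma eps0 I0 -> Rbar_le (Fin a) I0 ->
  exists Gam, effect D Gam /\ trm D Gam J > 1 - eps0 /\
              trm D Gam sigma <= 9 / 8 * Rpower 2 (- a).
Proof.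
  intros [_ Hlub] Ha; apply NNPP; intros Hno.
  set (tau := 9 / 8 * Rpower 2 (- a)).
  assert (Htau : 0 < tau) by (unfold tau; assert (H := Rpower2_pos (- a)); lra).
  assert (Hub : Rbar_le I0 (Fin (- log2 tau))).
  { apply Hlub; intros s [Gam [H1 [H2 [H3 ->]]]].
    assert (Ht : tau < re (mtrace D (mmul D Gam sigma))).
    { destruct (Rle_or_lt (re (mtrace D (mmul D Gam sigma))) tau) as [Hle|Hlt]; auto.
      exfalso; apply Hno; exists Gam; repeat split; auto; try apply H1; apply H2. }
    unfold neglog2; destruct (Req_EM_T _ 0) as [E|E]; [lra|]; simpl.
    apply Ropp_le_contravar, log2_le; lra. }
  assert (Hs := log2_slack (- a)); fold tau in Hs.
  destruct I0; simpl in *; lra.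
Qed.

(** The bound on the likelihood ratio is multiplied out, so that zero marginals need no
    convention. *)
Definition ratio_bound nu nv p (G : nat -> nat -> bool) (Lam : R) : Prop :=
  forall u v, (u < nu)%nat -> (v < nv)%nat -> G u v = true ->
    p u v <= Lam * (pU nv p u * pV nu p v).

Section RatioBound.
Context (nu nv : nat) (p : nat -> nat -> R) (p_nonneg : forall u v, 0 <= p u v).
Context (p_sum : rsum nu (fun u => rsum nv (fun v => p u v)) = 1).

Lemma logratio_ratio_bound G c :
  (forall u v, (u < nu)%nat -> (v < nv)%nat -> G u v = true ->
     Rbar_le (logratio nu nv p u v) (Fin c)) ->
  ratio_bound nu nv p G (Rpower 2 c).
Proof.
  intros H u v Hu Hv HG; specialize (H u v Hu Hv HG); unfold logratio in H.
  destruct (Req_EM_T (p u v) 0) as [E|E].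
  - rewrite E; apply Rmult_le_pos; [apply Rlt_le, Rpower2_pos|].
    apply Rmult_le_pos; apply rsum_nonneg; auto.
  - assert (Hp : 0 < p u v) by (destruct (p_nonneg u v); [auto|congruence]).
    assert (Hq := p_pos_marginals nu nv p p_nonneg u v Hu Hv Hp).
    simpl in H; apply log2_le_Rpower in H; [|now apply Rdiv_lt_0_compat].
    replace (p u v) with (p u v / (pU nv p u * pV nu p v) * (pU nv p u * pV nu p v)) at 1
      by (field; split; intros E0; rewrite E0 in Hq; lra).
    apply Rmult_le_compat_r; lra.
Qed.

(** If no [G] worked, every admissible value would be at least [log2 (9/8 * 2^b) > b], hence so
    would the infimum. *)
Lemma Iinf_witness epsinf Iinf b :
  is_Iinf nu nv p epsinf Iinf -> Rbar_le Iinf (Fin b) ->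
  exists G, probG nu nv p G > 1 - epsinf /\ ratio_bound nu nv p G (9 / 8 * Rpower 2 b).
Proof.
  intros [_ Hglb] Hb; apply NNPP; intros Hno.
  set (c := log2 (9 / 8 * Rpower 2 b)).
  assert (Hc : 9 / 8 * Rpower 2 b = Rpower 2 c).
  { unfold c; rewrite Rpower_log2; auto; assert (H := Rpower2_pos b); lra. }
  assert (Hlb : Rbar_le (Fin c) Iinf).
  { apply Hglb; intros s [G [HG [Hs _]]].
    destruct (classic (Rbar_le s (Fin c))) as [Hle|Hnle].
    - exfalso; apply Hno; exists G; split; auto; rewrite Hc.
      apply logratio_ratio_bound; intros u v Hu Hv HGuv.
      assert (H := Hs (logratio nu nv p u v)
                     (ex_intro _ u (ex_intro _ v (conj Hu (conj Hv (conj HGuv eq_refl)))))).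
      destruct (logratio nu nv p u v), s; simpl in *; auto; try contradiction; lra.
    - destruct s; simpl in *; auto; lra. }
  assert (Hslack := log2_slack b); fold c in Hslack.
  destruct Iinf; simpl in *; lra.
Qed.

(** This serves the case [Iinf = PInf], which arises for [epsinf = 0]: no [G] has probability above
    1, so the infimum is over the empty set. The 1 in [B] keeps its logarithm meaningful. *)
Lemma full_ratio_bound :
  exists b, ratio_bound nu nv p (fun _ _ => true) (Rpower 2 b).
Proof.
  set (G := fun _ _ : nat => true).
  set (B := 1 + rsum nu (fun u => rsum nv (fun v => weight nu nv p G u v))).
  assert (Hw := weight_nonneg nu nv p G p_nonneg).
  assert (HB : 0 < B).
  { unfold B; apply Rplus_lt_le_0_compat; [lra|].
    apply rsum_nonneg; intros u Hu; apply rsum_nonneg; auto. }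
  exists (log2 B); rewrite Rpower_log2 by auto; intros u v Hu Hv _.
  assert (Hs := weight_spec nu nv p G p_nonneg u v Hu Hv); simpl in Hs; rewrite <- Hs.
  rewrite Rmult_comm; apply Rmult_le_compat_r.
  - apply Rmult_le_pos; apply rsum_nonneg; auto.
  - assert (H1 := rsum_ge_term nv (fun v => weight nu nv p G u v) v (fun v Hv => Hw u v Hu Hv) Hv).
    assert (H2 := rsum_ge_term nu (fun u => rsum nv (fun v => weight nu nv p G u v)) u
                    (fun u Hu => rsum_nonneg _ _ (fun v Hv => Hw u v Hu Hv)) Hu).
    simpl in H1, H2; unfold B; lra.
Qed.

(** From here on only real numbers occur: an infinite quantity is replaced by a real one that still
    meets all three rate conditions. *)
Lemma finite_rates epsinf r1 r2 r12 I1 I2 Iinf :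
  0 <= epsinf <= 1 / 4 -> is_Iinf nu nv p epsinf Iinf ->
  Rbar_le (Fin r1) I1 -> Rbar_le (Fin r2) I2 ->
  Rbar_le (Rbar_plus (Fin r12) Iinf) (Rbar_plus I1 I2) ->
  exists a1 a2 b G, r1 <= a1 /\ r2 <= a2 /\ r12 + b <= a1 + a2 /\
    Rbar_le (Fin a1) I1 /\ Rbar_le (Fin a2) I2 /\
    3 / 4 <= probG nu nv p G /\ ratio_bound nu nv p G (9 / 8 * Rpower 2 b).
Proof.
  intros He Hinf H1 H2 H12.
  assert (Hb : exists b G, Rbar_le (Fin (r12 + b)) (Rbar_plus I1 I2) /\
    3 / 4 <= probG nu nv p G /\ ratio_bound nu nv p G (9 / 8 * Rpower 2 b)).
  { assert (Hw : forall b, Rbar_le Iinf (Fin b) -> exists G,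
      3 / 4 <= probG nu nv p G /\ ratio_bound nu nv p G (9 / 8 * Rpower 2 b)).
    { intros b Hb; destruct (Iinf_witness epsinf Iinf b Hinf Hb) as [G [HG Hr]].
      exists G; split; [lra|auto]. }
    destruct Iinf as [b| |].
    - destruct (Hw b) as [G HG]; [simpl; lra|]; exists b, G; auto.
    - destruct full_ratio_bound as [b Hr].
      exists b, (fun _ _ => true); split; [|split].
      + destruct I1, I2; simpl in *; auto; contradiction.
      + unfold probG; simpl; rewrite p_sum; lra.
      + intros u v Hu Hv HG; apply Rle_trans with (1 := Hr u v Hu Hv HG).
        apply Rmult_le_compat_r; [|assert (H := Rpower2_pos b); lra].
        apply Rmult_le_pos; apply rsum_nonneg; auto.
    (* For [Iinf = MInf] every real [b] is allowed; a finite sum [I1 + I2] is met with equality. *)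
    - destruct (Hw (match Rbar_plus I1 I2 with Fin s => s - r12 | _ => 0 end) I) as [G HG].
      eexists; exists G; split; [|exact HG].
      destruct I1, I2; simpl in *; auto; try contradiction; lra. }
  destruct Hb as [b [G [Hsum HG]]].
  destruct I1 as [x1| |], I2 as [x2| |]; simpl in *; try contradiction.
  - exists x1, x2, b, G; repeat split; try apply HG; auto; lra.
  (* An infinite [I2] lets the second rate be raised until the sum condition holds. *)
  - exists x1, (Rmax r2 (r12 + b - x1)), b, G; simpl.
    assert (Hl := Rmax_l r2 (r12 + b - x1)); assert (Hr := Rmax_r r2 (r12 + b - x1)).
    repeat split; try apply HG; auto; lra.
  - exists (Rmax r1 (r12 + b - x2)), x2, b, G; simpl.
    assert (Hl := Rmax_l r1 (r12 + b - x2)); assert (Hr := Rmax_r r1 (r12 + b - x2)).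
    repeat split; try apply HG; auto; lra.
  - exists (Rmax r1 (r12 + b - r2)), r2, b, G; simpl.
    assert (Hl := Rmax_l r1 (r12 + b - r2)); assert (Hr := Rmax_r r1 (r12 + b - r2)).
    repeat split; try apply HG; auto; lra.
Qed.

End RatioBound.

(** [up y] lies strictly above [y], so [up y - 1] is the floor; for [y >= 1] it is at least half of
    [y]. *)
Lemma nat_floor_half y : 1 <= y -> exists K, (1 <= K)%nat /\ INR K <= y <= 2 * INR K.
Proof.
  intros Hy; destruct (archimed y) as [Hup Hup1].
  assert (Hz : (1 <= up y - 1)%Z).
  { assert (1 < up y)%Z by (apply lt_IZR; lra); lia. }
  exists (Z.to_nat (up y - 1)); split; [lia|].
  assert (E : INR (Z.to_nat (up y - 1)) = IZR (up y) - 1)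
    by (rewrite INR_IZR_INZ, Z2Nat.id, minus_IZR by lia; reflexivity).
  apply IZR_le in Hz; rewrite minus_IZR in Hz; rewrite E; lra.
Qed.

(* [K] and [L] are the integer parts of [et / (m1 * tB)] and [et / (m2 * tC)]. *)
Lemma bin_sizes (et m1 m2 tB tC Lam : R) :
  0 < et < 1 -> 0 < m1 -> 0 < m2 -> 0 < tB -> 0 < tC -> 0 <= Lam ->
  3 * (m1 * tB) <= et ^ 5 -> 3 * (m2 * tC) <= et ^ 5 ->
  16 * (m1 * tB * (m2 * tC) * Lam) <= et ^ 11 ->
  exists K L, (1 <= K)%nat /\ (1 <= L)%nat /\
    m1 * INR K * tB <= et /\ m2 * INR L * tC <= et /\
    Lam + INR K + INR L <= 2 * et * (INR K * INR L).
Proof.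
  intros Het Hm1 Hm2 HtB HtC HLam.
  assert (Hx1 : 0 < m1 * tB) by now apply Rmult_lt_0_compat.
  assert (Hx2 : 0 < m2 * tC) by now apply Rmult_lt_0_compat.
  replace (m1 * tB * (m2 * tC) * Lam) with ((m1 * tB) * (m2 * tC) * Lam) by ring.
  intros H1 H2 H12.
  assert (Hpow : forall n, 0 < et ^ n <= 1).
  { intros n; split; [now apply pow_lt|].
    rewrite <- (pow1 n); apply pow_incr; lra. }
  (* [K] is the floor of [et / x], which loses at most a factor 2. With [3 x <= et^5 <= et^2] this
     gives [et K >= et^2 / (2 x) >= 3/2]. *)
  assert (Hfl : forall x, 0 < x -> 3 * x <= et ^ 5 ->
    exists K, (1 <= K)%nat /\ x * INR K <= et /\ et <= 2 * (x * INR K) /\ 3 / 2 <= et * INR K).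
  { intros x Hx Hxe.
    assert (Hxe4 : 3 * x <= et ^ 2).
    { apply Rle_trans with (1 := Hxe).
      replace (et ^ 5) with (et ^ 2 * et ^ 3) by ring.
      destruct (Hpow 2%nat), (Hpow 3%nat); nra. }
    assert (Hxe1 : 3 * x <= et) by (simpl in Hxe4; nra).
    destruct (nat_floor_half (et / x)) as [K [HK [HK1 HK2]]].
    { apply Rmult_le_reg_r with (1 := Hx); unfold Rdiv.
      rewrite Rmult_assoc, Rinv_l; lra. }
    assert (E : et / x * x = et) by (field; lra).
    apply (Rmult_le_compat_r x) in HK1; [|lra].
    apply (Rmult_le_compat_r x) in HK2; [|lra].
    rewrite E in HK1, HK2.
    exists K; split; [auto|]; split; [lra|]; split; [lra|].
    assert (Hee : 3 * x <= 2 * (x * INR K) * et).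
    { apply Rle_trans with (1 := Hxe4); replace (et ^ 2) with (et * et) by ring.
      apply Rmult_le_compat_r; lra. }
    apply Rmult_le_reg_l with (1 := Hx); lra. }
  destruct (Hfl _ Hx1 H1) as [K [HK [HK1 [HK2 HK3]]]].
  destruct (Hfl _ Hx2 H2) as [L [HL [HL1 [HL2 HL3]]]].
  exists K, L; split; [auto|]; split; [auto|].
  split; [replace (m1 * INR K * tB) with (m1 * tB * INR K) by ring; auto|].
  split; [replace (m2 * INR L * tC) with (m2 * tC * INR L) by ring; auto|].
  apply le_INR in HK; apply le_INR in HL; simpl in HK, HL.
  set (k := INR K) in *; set (l := INR L) in *.
  set (x := m1 * tB) in *; set (y := m2 * tC) in *.
  (* Each of [k] and [l] is at most 2/3 of [et k l], and [Lam] is at most 1/4 of it; the sum 19/12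
     stays below 2. *)
  assert (Hk : 3 / 2 * l <= et * k * l) by (apply Rmult_le_compat_r; lra).
  assert (Hl : 3 / 2 * k <= et * l * k) by (apply Rmult_le_compat_r; lra).
  assert (HLam2 : 4 * Lam <= et * (k * l)).
  { assert (Hxy : et ^ 2 <= 4 * (x * y * (k * l))).
    { replace (et ^ 2) with (et * et) by ring.
      apply Rle_trans with (2 * (x * k) * (2 * (y * l))); [|lra].
      apply Rmult_le_compat; lra. }
    assert (Hp : 0 < x * y) by now apply Rmult_lt_0_compat.
    apply Rmult_le_reg_l with (1 := Hp).
    apply Rle_trans with (et ^ 11 / 4); [lra|].
    replace (et ^ 11) with (et * et ^ 8 * et ^ 2) by ring.
    apply Rle_trans with (et * et ^ 2 / 4).
    - destruct (Hpow 8%nat), (Hpow 2%nat).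
      assert (et * et ^ 8 <= et * 1) by (apply Rmult_le_compat_l; lra).
      assert (et * et ^ 8 * et ^ 2 <= et * 1 * et ^ 2) by (apply Rmult_le_compat_r; lra).
      lra.
    - assert (et * et ^ 2 <= et * (4 * (x * y * (k * l)))) by (apply Rmult_le_compat_l; lra).
      lra. }
  lra.
Qed.

Lemma log2_rate_le x a : 0 < x -> log2 x <= a -> x * Rpower 2 (- a) <= 1.
Proof.
  intros Hx H; apply log2_le_Rpower in H; auto.
  replace 1 with (Rpower 2 a * Rpower 2 (- a))
    by (rewrite <- Rpower_plus, Rplus_opp_r; apply Rpower_O; lra).
  apply Rmult_le_compat_r; [apply Rlt_le, Rpower2_pos|auto].
Qed.

Lemma expected_miss nu nv p a e :
  rsum nu (fun u => rsum nv (fun v => p u v)) = 1 ->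
  rsum nu (fun u => rsum nv (fun v => p u v * a u v)) > 1 - e ->
  rsum nu (fun u => rsum nv (fun v => p u v * (1 - a u v))) <= e.
Proof.
  intros Hp Ha.
  rewrite (rsum_ext nu _ (fun u => rsum nv (fun v => p u v)
                                   + -1 * rsum nv (fun v => p u v * a u v))).
  - rewrite rsum_plus, rsum_scal; lra.
  - intros u _; rewrite <- rsum_scal, <- rsum_plus; apply rsum_ext; intros; ring.
Qed.

(** * Error probabilities on a single output state *)

Section Marginals.
Context (dB dC : nat) (rho : Mat) (rho_density : density (dB * dC) rho).

Lemma ptrC_psd_pos A : psd dB A -> 0 <= trm dB A (ptrC dC rho).
Proof.
  intros HA; rewrite <- trm_kron_idm_r; apply trm_kron_psd; auto; [apply psd_idm|].
  apply rho_density.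
Qed.

Lemma ptrB_psd_pos A : psd dC A -> 0 <= trm dC A (ptrB dB dC rho).
Proof.
  intros HA; rewrite <- trm_kron_idm_l; apply trm_kron_psd; auto; [apply psd_idm|].
  apply rho_density.
Qed.

Lemma trm_idm_density : trm (dB * dC) (kron dC idm idm) rho = 1.
Proof.
  rewrite (trm_ext _ _ idm _ rho); [|apply kron_idm|auto].
  rewrite trm_idm; now rewrite (proj2 rho_density).
Qed.

Lemma ptrC_complement A :
  trm dB (msub idm A) (ptrC dC rho) = 1 - trm dB A (ptrC dC rho).
Proof. now rewrite trm_msub_l, <- (trm_kron_idm_r dB dC idm), trm_idm_density. Qed.

Lemma ptrB_complement A :
  trm dC (msub idm A) (ptrB dB dC rho) = 1 - trm dC A (ptrB dB dC rho).
Proof. now rewrite trm_msub_l, <- (trm_kron_idm_l dB dC idm), trm_idm_density. Qed.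

Lemma ptrC_effect_range A : effect dB A -> 0 <= trm dB A (ptrC dC rho) <= 1.
Proof.
  intros [H1 H2]; apply ptrC_psd_pos in H1; apply ptrC_psd_pos in H2.
  rewrite ptrC_complement in H2; lra.
Qed.

Lemma ptrB_effect_range A : effect dC A -> 0 <= trm dC A (ptrB dB dC rho) <= 1.
Proof.
  intros [H1 H2]; apply ptrB_psd_pos in H1; apply ptrB_psd_pos in H2.
  rewrite ptrB_complement in H2; lra.
Qed.

Lemma error_le_1 A B :
  psd dB A -> psd dC B -> trm (dB * dC) (msub idm (kron dC A B)) rho <= 1.
Proof.
  intros HA HB.
  assert (H := trm_kron_psd dB dC A B rho HA HB (proj1 rho_density)).
  rewrite trm_msub_l.
  assert (H1 := trm_idm_density).
  rewrite (trm_ext _ _ idm _ rho) in H1 by (apply kron_idm || auto).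
  lra.
Qed.

End Marginals.

Lemma povm_effect d n T m : povm d n T -> (m < n)%nat -> effect d (T m).
Proof.
  intros [Hpos Hsum] Hm; split; [auto|]; split.
  - apply hermitian_msub; [apply hermitian_idm|apply (Hpos m Hm)].
  - intros x; change (0 <= form d (msub idm (T m)) x).
    rewrite form_msub.
    assert (E : form d idm x = rsum n (fun k => form d (T k) x)).
    { rewrite <- form_msum; unfold form; apply ip_ext; auto; intros i Hi.
      unfold mv; apply csum_ext; intros j Hj; now rewrite <- Hsum. }
    rewrite E.
    assert (H := rsum_ge_term n (fun k => form d (T k) x) m
                   (fun k Hk => psd_form _ _ _ (Hpos k Hk)) Hm); simpl in H; lra.
Qed.

(** [M1] and [M2] stand for [2^R1] and [2^R2]. In the sum-rate condition [Iinf] is moved to the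
    left, so that extended reals are never subtracted. *)
Theorem theorem3
  (nx dB dC : nat) (rho : nat -> Mat)
  (nu nv : nat) (p : nat -> nat -> R) (f : nat -> nat -> nat)
  (eps0 epsinf epst eps : R) (M1 M2 : nat)
  (I0UB I0VC Iinf : Rbar) :
  (forall x, (x < nx)%nat -> density (dB * dC) (rho x)) ->
  (forall u v, 0 <= p u v) ->
  rsum nu (fun u => rsum nv (fun v => p u v)) = 1 ->
  (forall u v, (u < nu)%nat -> (v < nv)%nat -> (f u v < nx)%nat) ->
  0 <= eps0 < 1 -> 0 <= epsinf <= 1/4 -> 0 < epst < 1 -> 0 < eps ->
  40 * epst + 16 * eps0 <= eps ->
  (1 <= M1)%nat -> (1 <= M2)%nat ->
  is_I0 (nu * dB) (rhoUB dB dC nu nv rho p f)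
        (kron dB (rhoU nu nv p) (rhoB dC nu nv rho p f)) eps0 I0UB ->
  is_I0 (nv * dC) (rhoVC dB dC nu nv rho p f)
        (kron dC (rhoV nu nv p) (rhoC dB dC nu nv rho p f)) eps0 I0VC ->
  is_Iinf nu nv p epsinf Iinf ->
  Rbar_le (Fin (log2 (INR M1) + 5 * log2 (1 / epst) + 2)) I0UB ->
  Rbar_le (Fin (log2 (INR M2) + 5 * log2 (1 / epst) + 2)) I0VC ->
  Rbar_le (Rbar_plus (Fin (log2 (INR M1) + log2 (INR M2) + 11 * log2 (1 / epst) + 5)) Iinf)
          (Rbar_plus I0UB I0VC) ->
  exists (F : nat -> nat -> nat) (TB TC : nat -> Mat),
    (forall m1 m2, (m1 < M1)%nat -> (m2 < M2)%nat -> (F m1 m2 < nx)%nat) /\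
    povm dB M1 TB /\ povm dC M2 TC /\
    / (INR M1 * INR M2) *
      rsum M1 (fun m1 => rsum M2 (fun m2 =>
        re (mtrace (dB * dC)
              (mmul (dB * dC) (msub idm (kron dC (TB m1) (TC m2))) (rho (F m1 m2))))))
    <= eps.
Proof.
  intros Hrho Hp Hsum Hf He0 Hei Het Heps Hle HM1 HM2 HUB HVC Hinf HR1 HR2 HR12.
  destruct (finite_rates nu nv p Hp Hsum epsinf _ _ _ _ _ _ Hei Hinf HR1 HR2 HR12)
    as [a1 [a2 [b [G [Ha1 [Ha2 [Hb [Hle1 [Hle2 [HG Hratio]]]]]]]]]].
  destruct (I0_witness _ _ _ _ _ _ HUB Hle1) as [GB [HGB [HGB1 HGB2]]].
  destruct (I0_witness _ _ _ _ _ _ HVC Hle2) as [GC [HGC [HGC1 HGC2]]].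
  set (tB := 9 / 8 * Rpower 2 (- a1)) in *.
  set (tC := 9 / 8 * Rpower 2 (- a2)) in *.
  set (Lam := 9 / 8 * Rpower 2 b) in *.
  assert (Pb := Rpower2_pos b); assert (P1 := Rpower2_pos (- a1)).
  assert (P2 := Rpower2_pos (- a2)).
  assert (HM1' : 0 < INR M1) by (apply lt_0_INR; lia).
  assert (HM2' : 0 < INR M2) by (apply lt_0_INR; lia).
  assert (Hinv : 0 < 1 / epst) by (apply Rdiv_lt_0_compat; lra).
  assert (Hinvpow : forall n, (1 / epst) ^ n * epst ^ n = 1).
  { intros n; rewrite <- Rpow_mult_distr.
    replace (1 / epst * epst) with 1 by (field; lra); apply pow1. }
  assert (Hpos : forall n, 0 < (1 / epst) ^ n) by (intros; now apply pow_lt).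
  assert (Hpos' : forall n, 0 < epst ^ n) by (intros; apply pow_lt; lra).
  (* The summand 2 of the rate condition gives a factor 4, which covers [3 * 9/8]. *)
  assert (Hsingle : forall m a, 0 < m -> log2 m + 5 * log2 (1 / epst) + 2 <= a ->
            3 * (m * (9 / 8 * Rpower 2 (- a))) <= epst ^ 5).
  { intros m a Hm Ha.
    assert (H : 2 ^ 2 * m * (1 / epst) ^ 5 * Rpower 2 (- a) <= 1).
    { apply log2_rate_le.
      - repeat apply Rmult_lt_0_compat; auto; lra.
      - rewrite !log2_mult, !log2_pow, log2_2 by
          (auto; try lra; repeat apply Rmult_lt_0_compat; auto; lra).
        simpl INR; lra. }
    apply Rmult_le_compat_l with (r := epst ^ 5) in H; [|apply Rlt_le, Hpos'].
    replace (epst ^ 5 * (2 ^ 2 * m * (1 / epst) ^ 5 * Rpower 2 (- a)))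
      with (4 * (m * Rpower 2 (- a)) * ((1 / epst) ^ 5 * epst ^ 5)) in H by ring.
    rewrite Hinvpow in H.
    assert (0 < m * Rpower 2 (- a)) by (apply Rmult_lt_0_compat; [auto|apply Rpower2_pos]).
    lra. }
  (* The summand 5 gives a factor 32, which covers [16 * (9/8)^3], one 9/8 for each of [tB], [tC]
     and [Lam]. *)
  assert (Hdouble : 16 * (INR M1 * tB * (INR M2 * tC) * Lam) <= epst ^ 11).
  { assert (H : 2 ^ 5 * INR M1 * INR M2 * (1 / epst) ^ 11 * Rpower 2 (- (a1 + a2 - b)) <= 1).
    { apply log2_rate_le.
      - repeat apply Rmult_lt_0_compat; auto; lra.
      - rewrite !log2_mult, !log2_pow, log2_2 by
          (auto; try lra; repeat apply Rmult_lt_0_compat; auto; lra).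
        simpl INR; lra. }
    replace (- (a1 + a2 - b)) with (- a1 + (- a2 + b)) in H by ring.
    rewrite !Rpower_plus in H.
    apply Rmult_le_compat_l with (r := epst ^ 11) in H; [|apply Rlt_le, Hpos'].
    set (X := INR M1 * INR M2 * (Rpower 2 (- a1) * (Rpower 2 (- a2) * Rpower 2 b))).
    match type of H with ?l <= _ =>
      replace l with (32 * X * ((1 / epst) ^ 11 * epst ^ 11)) in H by (unfold X; ring) end.
    rewrite Hinvpow in H.
    assert (0 < X) by (unfold X; repeat apply Rmult_lt_0_compat; auto).
    replace (INR M1 * tB * (INR M2 * tC) * Lam) with (729 / 512 * X)
      by (unfold X, tB, tC, Lam; field).
    lra. }
  assert (HtB : 0 < tB) by (unfold tB; lra).
  assert (HtC : 0 < tC) by (unfold tC; lra).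
  assert (HLam : 0 < Lam) by (unfold Lam; lra).
  destruct (bin_sizes epst (INR M1) (INR M2) tB tC Lam Het HM1' HM2' HtB HtC
              (Rlt_le _ _ HLam) (Hsingle _ _ HM1' Ha1) (Hsingle _ _ HM2' Ha2) Hdouble)
    as [K [L [HK [HL [HKB [HLC HKL]]]]]].
  set (alpha := fun u' u v => trm dB (block dB u' GB) (rhoB_x dC rho (f u v))).
  set (beta := fun v' u v => trm dC (block dC v' GC) (rhoC_x dB dC rho (f u v))).
  destruct (good_code nu nv p G Hp Hsum alpha beta tB tC eps0) with
    (Lam := Lam) (et := epst) (M1 := M1) (M2 := M2) (K := K) (L := L)
    as [c [c' [kk [ll [Hc [Hc' [Hkl Hcost]]]]]]]; auto; try lra.
  - intros u' u v Hu' Hu Hv; apply ptrC_effect_range; [auto|now apply (effect_block nu)].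
  - intros v' u v Hv' Hu Hv; apply ptrB_effect_range; [auto|now apply (effect_block nv)].
  - apply expected_miss; auto.
    unfold rhoUB in HGB1; rewrite trm_cq_state in HGB1 by auto; exact HGB1.
  - apply expected_miss; auto.
    unfold rhoVC in HGC1; rewrite trm_cq_state in HGC1 by auto; exact HGC1.
  - unfold rhoU, rhoB in HGB2; rewrite trm_product_state in HGB2; exact HGB2.
  - unfold rhoV, rhoC in HGC2; rewrite trm_product_state in HGC2; exact HGC2.
  - set (GamB := fun i => block dB (c i) GB); set (GamC := fun j => block dC (c' j) GC).
    assert (HGamB : forall i, effect dB (GamB i)) by (intros i; now apply (effect_block nu)).
    assert (HGamC : forall j, effect dC (GamC j)) by (intros j; now apply (effect_block nv)).
    assert (HTB := decoder_povm dB K M1 GamB HM1 HGamB).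
    assert (HTC := decoder_povm dC L M2 GamC HM2 HGamC).
    exists (fun m1 m2 => f (c (m1 * K + kk m1 m2)%nat) (c' (m2 * L + ll m1 m2)%nat)),
      (decoder dB K M1 GamB), (decoder dC L M2 GamC).
    split; [auto|]; split; [auto|]; split; [auto|].
    apply Rmult_le_reg_l with (INR M1 * INR M2); [now apply Rmult_lt_0_compat|].
    rewrite <- Rmult_assoc, Rinv_r, Rmult_1_l
      by (apply Rgt_not_eq, Rlt_gt; now apply Rmult_lt_0_compat).
    apply Rle_trans with (INR M1 * INR M2 * (16 * eps0 + 40 * epst)).
    2:{ apply Rmult_le_compat_l; [|lra]. apply Rlt_le; now apply Rmult_lt_0_compat. }
    apply Rle_trans with (2 := Hcost).
    apply rsum_le; intros m1 Hm1; apply rsum_le; intros m2 Hm2.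
    destruct (Hkl m1 m2) as [Hk Hl].
    set (i := (m1 * K + kk m1 m2)%nat); set (j := (m2 * L + ll m1 m2)%nat).
    set (r := rho (f (c i) (c' j))).
    assert (Hr : density (dB * dC) r) by (apply Hrho, Hf; auto).
    match goal with |- re (mtrace ?d (mmul ?d ?A ?B)) <= _ => change (trm d A B <= Rmin 1
      (cost alpha beta c c' i j)) end.
    (* The encoder minimised the truncated cost, so the error must be below both 1 and the cost. *)
    apply Rmin_glb.
    + apply error_le_1; [auto|apply HTB|apply HTC]; auto.
    + apply Rle_trans with (1 := trm_kron_union dB dC _ _ r
        (povm_effect _ _ _ _ HTB Hm1) (povm_effect _ _ _ _ HTC Hm2) (proj1 Hr)).
      unfold cost; apply Rplus_le_compat.
      * apply Rle_trans with (1 := decoder_error_trm dB K M1 GamB m1 (kk m1 m2) _ HGamB Hk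
          (ptrC_psd_pos dB dC r Hr)).
        fold i; rewrite ptrC_complement by auto; apply Rle_refl.
      * apply Rle_trans with (1 := decoder_error_trm dC L M2 GamC m2 (ll m1 m2) _ HGamC Hl
          (ptrB_psd_pos dB dC r Hr)).
        fold j; rewrite ptrB_complement by auto; apply Rle_refl.
Qed.
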